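(* Let $n\ge 2$ and $0<s<1$. For every $y>0$ the function $$v_y(x)=\kappa(n,s)\left(\frac{y}{y^2+|x|^2}\right)^{\frac{n-2s}{2}},\qquad \kappa(n,s)=2^{\frac{n-2s}{2}}\left(\frac{\Gamma\left(\frac{n+2s}{2}\right)}{\Gamma\left(\frac{n-2s}{2}\right)}\right)^{\frac{n-2s}{4s}},$$ solves the nonlocal Yamabe equation $$(-\Delta)^s v=v^{\frac{n+2s}{n-2s}}\qquad\text{in }\mathbb R^n .$$ Every translation in $x$ of such a function is also a solution.
   Context: For $v\in C^2(\mathbb R^n)\cap L^\infty(\mathbb R^n)$, $$(-\Delta)^s v(x)=\frac{\gamma(n,s)}{2}\int_{\mathbb R^n}\frac{2v(x)-v(x+z)-v(x-z)}{|z|^{n+2s}}\,dz,\qquad \gamma(n,s)=\frac{s\,2^{2s}\,\Gamma\left(\frac{n+2s}{2}\right)}{\pi^{n/2}\,\Gamma(1-s)}.$$ *)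

(* Defs.v *)
From HB Require Import structures.
From mathcomp Require Import all_boot all_order all_algebra.
From mathcomp Require Import all_classical all_reals all_analysis.

Set Implicit Arguments.
Unset Strict Implicit.
Unset Printing Implicit Defensive.
Import Order.TTheory GRing.Theory Num.Theory.
Import numFieldNormedType.Exports.
Local Open Scope classical_set_scope.
Local Open Scope ring_scope.

Section lebesgue_cons.
Local Open Scope ereal_scope.
Context {R : realType} (n : nat).
Variable mu : {sigma_finite_measure set (n.-tuple (measurableTypeR R)) -> \bar R}.

Definition tuple_cons (p : measurableTypeR R * n.-tuple (measurableTypeR R)) :
  n.+1.-tuple (measurableTypeR R) := [tuple of p.1 :: p.2].

Lemma measurable_tuple_cons : measurable_fun [set: _] tuple_cons.
Proof. exact: measurable_cons. Qed.

Definition lebesgue_cons : set (n.+1.-tuple (measurableTypeR R)) -> \bar R :=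
  pushforward (@lebesgue_measure R \x mu) tuple_cons.

Let lebesgue_cons0 : lebesgue_cons set0 = 0.
Proof. by rewrite /lebesgue_cons /pushforward preimage_set0 measure0. Qed.

Let lebesgue_cons_ge0 A : 0 <= lebesgue_cons A.
Proof. exact: (measure_ge0 (@lebesgue_measure R \x mu)). Qed.

Let lebesgue_cons_sigma_additive : semi_sigma_additive lebesgue_cons.
Proof.
move=> F mF tF mUF; rewrite /lebesgue_cons /pushforward preimage_bigcup.
apply: measure_semi_sigma_additive.
- by move=> k; rewrite -[X in measurable X]setTI; exact: measurable_tuple_cons.
- apply/trivIsetP => /= i j _ _ ij; rewrite -preimage_setI.
  by move/trivIsetP : tF => /(_ _ _ _ _ ij) ->//; rewrite preimage_set0.
- rewrite -preimage_bigcup -[X in measurable X]setTI.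
  exact: measurable_tuple_cons.
Qed.

HB.instance Definition _ := isMeasure.Build _ _ _ lebesgue_cons
  lebesgue_cons0 lebesgue_cons_ge0 lebesgue_cons_sigma_additive.

(* The library's sigma-finite instance for m1 \x m2 is not inferred here: it is
   shadowed by the one for products of subprobabilities. *)
Let sigma_finite_lebesgue_cons : sigma_finite [set: _] lebesgue_cons.
Proof.
have /sigma_finiteP[A [TA ndA Aoo]] := sigma_finiteT (@lebesgue_measure R).
have /sigma_finiteP[B [TB ndB Boo]] := sigma_finiteT mu.
pose hd := fun t : n.+1.-tuple (measurableTypeR R) => tnth t ord0.
pose tl := fun t : n.+1.-tuple (measurableTypeR R) => [tuple of behead t].
exists (fun k => hd @^-1` A k `&` tl @^-1` B k).
  apply/esym; rewrite -subTset => t _.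
  have [k _ Akt] : (\bigcup_i A i) (hd t) by rewrite -TA.
  have [l _ Blt] : (\bigcup_i B i) (tl t) by rewrite -TB.
  exists (maxn k l) => //; split.
    by rewrite /preimage/=; move: (hd t) Akt; exact/subsetPset/ndA/leq_maxl.
  by rewrite /preimage/=; move: (tl t) Blt; exact/subsetPset/ndB/leq_maxr.
move=> k; have [mA Aky] := Aoo k; have [mB Bky] := Boo k; split.
  apply: measurableI.
    by rewrite -[X in measurable X]setTI; exact: measurable_tnth.
  by rewrite -[X in measurable X]setTI; exact: measurable_behead.
rewrite /lebesgue_cons /pushforward (_ : _ @^-1` _ = A k `*` B k).
  by rewrite product_measure1E// lte_mul_pinfty// ge0_fin_numE.
have consE p : hd (tuple_cons p) = p.1 /\ tl (tuple_cons p) = p.2.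
  by split; [exact: tnth0|exact: val_inj].
by apply/seteqP; split=> p /=; have [-> ->] := consE p.
Qed.

HB.instance Definition _ := Measure_isSigmaFinite.Build _ _ _ lebesgue_cons
  sigma_finite_lebesgue_cons.

End lebesgue_cons.

(* n-dimensional Lebesgue measure, as the iterated product of the
   one-dimensional one; its values are transported along (x, t) |-> x :: t. *)
Fixpoint lebesgue_tuple (R : realType) (n : nat) :
    {sigma_finite_measure set (n.-tuple (measurableTypeR R)) -> \bar R} :=
  match n with
  | 0 => \d_[tuple]
  | n'.+1 => lebesgue_cons (lebesgue_tuple R n')
  end.

Section fractional_laplacian.
Context {R : realType}.

(* Euclidean norm: the library norm `|x| on 'rV[R]_n is the sup norm. *)
Definition enorm (n : nat) (x : 'rV[R]_n) : R :=
  Num.sqrt (\sum_(i < n) x ord0 i ^+ 2).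

Definition vec_of_tuple (n : nat) (t : n.-tuple R) : 'rV[R]_n :=
  \row_i tnth t i.

Fixpoint is_Ck (k n : nat) (v : 'rV[R]_n -> R) : Prop :=
  match k with
  | 0 => continuous v
  | k'.+1 => continuous v /\ forall i : 'I_n,
      (forall x, derivable v x (delta_mx ord0 i)) /\
      is_Ck k' ('D_(delta_mx ord0 i) v)
  end.

Definition is_Linfty (n : nat) (v : 'rV[R]_n -> R) : Prop :=
  (fun t => v (vec_of_tuple t)) \in Lfun (lebesgue_tuple R n) +oo%E.

Definition Gamma (a : R) : R :=
  \int[lebesgue_measure]_(t in `]0, +oo[) (t `^ (a - 1) * expR (- t)).

Definition frac_const (n : nat) (s : R) : R :=
  s * 2 `^ (2 * s) * Gamma ((n%:R + 2 * s) / 2) /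
  (pi `^ (n%:R / 2) * Gamma (1 - s)).

(* Meaningful for v in C^2 and L^infty, where the integrand is integrable. *)
Definition frac_laplacian (n : nat) (s : R) (v : 'rV[R]_n -> R) (x : 'rV[R]_n)
    : R :=
  frac_const n s / 2 *
  \int[lebesgue_tuple R n]_t
    (let z := vec_of_tuple t in
     (2 * v x - v (x + z) - v (x - z)) / enorm z `^ (n%:R + 2 * s)).

(* Nonnegativity makes the real power on the right-hand side meaningful. *)
Definition solves_yamabe (n : nat) (s : R) (v : 'rV[R]_n -> R) : Prop :=
  [/\ is_Ck 2 v, is_Linfty v, forall x, 0 <= v x &
     forall x, frac_laplacian s v x =
               v x `^ ((n%:R + 2 * s) / (n%:R - 2 * s))].

Definition bubble_const (n : nat) (s : R) : R :=
  2 `^ ((n%:R - 2 * s) / 2) *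
  (Gamma ((n%:R + 2 * s) / 2) / Gamma ((n%:R - 2 * s) / 2))
    `^ ((n%:R - 2 * s) / (4 * s)).

Definition bubble (n : nat) (s y : R) (x : 'rV[R]_n) : R :=
  bubble_const n s *
  (y / (y ^+ 2 + enorm x ^+ 2)) `^ ((n%:R - 2 * s) / 2).

End fractional_laplacian.

(* Main.v *)
(* With a = (n - 2s)/2, b = (n + 2s)/2 and D = y^2 + |x|^2, the bubble is a
   multiple of D^(-a), and its second difference splits into two parts of
   constant sign,
     2 [D^(-a) - (D + |z|^2)^(-a)]
     - [w(x + z) + w(x - z) - 2 (D + |z|^2)^(-a)],   w = (y^2 + |.|^2)^(-a).
   Write each part as a Gamma integral in t of Gaussians and the kernel as
     Gamma(b) |z|^(-2b) = t^b \int w^(b-1) exp(-t w |z|^2) dw,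
   where the parameter of the kernel is scaled by t.  By Tonelli the Gaussian
   integral in z and then the Gamma integral in t can be computed at fixed w;
   since a + b = n the two parts then differ by
     w^(b-1) [(w D)^(-n/2) - (y^2 + w D)^(-n/2)],
   whose integral over w > 0 is again made of Gamma integrals. *)

From HB Require Import structures.
Require Import Defs.
From mathcomp Require Import all_boot all_order all_algebra.
From mathcomp Require Import all_classical all_reals all_analysis.
From mathcomp Require Import measurable_realfun ess_sup_inf.
From mathcomp Require Import ring lra.

Import Order.TTheory GRing.Theory Num.Theory.
Import numFieldNormedType.Exports.
Local Open Scope classical_set_scope.
Local Open Scope ring_scope.

(** By the parallelogram law D + |z|^2 is the midpoint of y^2 + |x + z|^2 and y^2 + |x - z|^2, so
    one part is monotone in |z|^2 and the other is signed by convexity of u^(-a). Both parts also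
    vanish at z = 0, and so do their Gaussian representations. Scaling the kernel parameter by t
    makes every exponent t times a quadratic polynomial in z: the Gaussian integral then yields
    t^(-n/2) times a function of w, and only a pure exponential in t is left. Completing the square
    in |x + z|^2 + w |z|^2 leaves w/(1 + w) |x|^2, and (1 + w) (y^2 + w/(1 + w) |x|^2) = y^2 + w D,
    which is why x survives only through D. The final w-integral is proportional to y^(2s) D^(-b),
    and D^(-b) is the power of D that the critical exponent b/a produces from D^(-a). *)

Lemma gt0_powRD {R : realType} (x r t : R) : 0 < x -> x `^ (r + t) = x `^ r * x `^ t.
Proof. by move=> x0; rewrite powRD// (gt_eqF x0) implybT. Qed.

Lemma powR_div {R : realType} (x c r : R) : 0 <= x -> 0 <= c ->
  (x / c) `^ r = x `^ r * c `^ (- r).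
Proof. by move=> x0 c0; rewrite powRM ?invr_ge0// -(powR_inv1 c0) -powRrM mulN1r. Qed.

(** AM-GM twice: p r <= ((p + r)/2)^2 bounds the value at the midpoint by the geometric mean of the
    end values, and that mean is at most their arithmetic mean. This gives the sign of the convex
    part. *)
Lemma powRN_midpoint {R : realType} (p r c : R) : 0 < c -> 0 < p -> 0 < r ->
  2 * ((p + r) / 2) `^ (- c) <= p `^ (- c) + r `^ (- c).
Proof.
move=> c0 p0 r0.
have sqE u : 0 < u -> u `^ (- c) = (u `^ (- (c / 2))) ^+ 2.
  by move=> u0; rewrite -powR_mulrn ?powR_ge0// -powRrM; congr (_ `^ _); field.
have pr0 : 0 < (p + r) / 2 by rewrite divr_gt0// addr_gt0.
have le_pr : (((p + r) / 2) `^ (- (c / 2))) ^+ 2 <= p `^ (- (c / 2)) * r `^ (- (c / 2)).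
  rewrite -(powRM _ (ltW p0) (ltW r0)) -powR_mulrn ?powR_ge0// powRAC.
  rewrite powR_mulrn ?(ltW pr0)// !powRN.
  have s20 : 0 < ((p + r) / 2) ^+ 2 by rewrite exprn_gt0.
  have pr00 : 0 < p * r by rewrite mulr_gt0.
  rewrite lef_pV2 ?posrE ?powR_gt0//.
  rewrite ge0_ler_powR ?nnegrE ?(ltW s20) ?(ltW pr00) ?divr_ge0 ?(ltW c0)//.
  rewrite -subr_ge0 (_ : _ - _ = ((p - r) / 2) ^+ 2) ?sqr_ge0//.
  by field.
rewrite !sqE//; set u := p `^ _ in le_pr *; set v := r `^ _ in le_pr *.
by have := sqr_ge0 (u - v); rewrite sqrrB; lra.
Qed.

Lemma measurable_expRN {R : realType} d (T : measurableType d) (D : set T) (f : T -> R) :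
  measurable_fun D f -> measurable_fun D (fun x => expR (- f x)).
Proof. by move=> mf; apply: measurableT_comp => //; exact: measurableT_comp. Qed.

(** * Scaling and power functions on the half-line *)

Section halfline.
Context {R : realType}.
Local Notation mu := (@lebesgue_measure R).

(** Uniqueness of Lebesgue measure: [c] times its image under t -> c t gives each interval ]a, b]
    its length. *)
Lemma ge0_integral_scale (f : R -> \bar R) (c : R) : 0 < c ->
  measurable_fun [set: R] f -> (forall r, 0 <= f r)%E ->
  (\int[mu]_(t in `]0%R, +oo[) f (c * t)%R = c^-1%:E * \int[mu]_(t in `]0%R, +oo[) f t)%E.
Proof.
move=> c0 mf f0.
pose g : measurableTypeR R -> measurableTypeR R := fun t => c * t.
have mg : measurable_fun setT g by apply: measurable_funM => //; exact: measurable_id.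
pose gm : {mfun measurableTypeR R >-> measurableTypeR R} :=
  HB.pack g (isMeasurableFun.Build _ _ _ _ g mg).
pose c' := NngNum (ltW c0).
have scaleE (A : set R) : measurable A -> mu A = mscale c' (pushforward mu gm) A.
  have /(_ mg) := @lebesgue_measure_unique R (mscale c' (pushforward mu gm)).
  apply=> //.
  move=> _ [[a b]] _ <-.
  rewrite [RHS](_ : _ = c%:E * mu (g @^-1` `]a, b]))%E//.
  have -> : g @^-1` `]a, b] = `]c^-1 * a, c^-1 * b]%classic.
    by apply/seteqP; split => x /=; rewrite !in_itv/= ltr_pdivrMl// ler_pdivlMl.
  rewrite !lebesgue_measure_itv/= !lte_fin ltr_pM2l ?invr_gt0//.
  case: ifPn => _; last by rewrite mule0.
  by rewrite -!EFinB -EFinM -mulrBr mulrA divff ?mul1r// gt_eqF.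
have gpos : g @^-1` `]0%R, +oo[%classic = `]0%R, +oo[%classic.
  by apply/seteqP; split => x /=; rewrite !in_itv/= !andbT /g pmulr_rgt0.
rewrite -{1}gpos.
transitivity (\int[mu]_(t in gm @^-1` `]0%R, +oo[) (f \o gm) t)%E => //.
rewrite -ge0_integral_pushforward//=; last exact: measurable_funS mf.
rewrite [in RHS](eq_measure_integral (mscale c' (pushforward mu gm))); last first.
  by move=> A mA _; exact: scaleE.
rewrite ge0_integral_mscale//; last exact: measurable_funS mf.
by rewrite muleA -EFinM mulVf ?mul1e// gt_eqF.
Qed.

Lemma integral_powR_itvcc (p a c : R) : p != 0 -> 0 < a -> a < c ->
  (\int[mu]_(x in `[a, c]) (x `^ (p - 1))%:E = ((c `^ p - a `^ p) / p)%:E)%E.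
Proof.
move=> p0 a0 ac.
have cpow q (x : R) : 0 < x -> {for x, continuous (fun x : R => x `^ q)}.
  move=> x0; apply/differentiable_continuous/derivable1_diffP.
  by apply: derivable_powR; rewrite in_itv/= x0.
have cF (x : R) : 0 < x -> {for x, continuous (fun x : R => x `^ p / p)}.
  by move=> x0; apply: cvgMl; exact: cpow.
rewrite (@continuous_FTC2 _ _ (fun x => x `^ p / p))//.
- by rewrite -EFinB mulrBl.
- apply: continuous_in_subspaceT => x; rewrite inE/= in_itv/= => /andP[ax _].
  by apply: cpow; exact: lt_le_trans ax.
- split.
  + move=> x; rewrite in_itv/= => /andP[ax _].
    apply: derivableM; last exact: derivable_cst.
    by apply: derivable_powR; rewrite in_itv/= (lt_trans a0).
  + by apply/cvg_at_right_filter/cF.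
  + by apply/cvg_at_left_filter/cF; exact: lt_trans ac.
- move=> x; rewrite in_itv/= => /andP[ax _].
  have x0 : 0 < x by exact: lt_trans ax.
  rewrite derive1E deriveMr; last by apply: derivable_powR; rewrite in_itv/= x0.
  rewrite -derive1E powR_derive1 ?in_itv/= ?x0//.
  by rewrite mulrA mulVf ?mul1r.
Qed.

Lemma integral_powR_itv0c (p c : R) : 0 < p -> 0 < c ->
  (\int[mu]_(x in `]0%R, c]) (x `^ (p - 1))%:E = (c `^ p / p)%:E)%E.
Proof.
move=> p0 c0.
(* For p < 1 the integrand is singular at 0, so the closed-interval formula is used on an exhaustion
   away from 0. Dividing by [k.+2] keeps the left end strictly below [c] already for k = 0. *)
pose F k : set R := `[c / k.+2%:R, c]%classic.
have FE : `]0%R, c]%classic = \bigcup_k F k.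
  apply/seteqP; split=> x /=; rewrite in_itv/=.
    move=> /andP[x0 xc].
    exists (Num.truncn (c / x)) => //; rewrite /F/= in_itv/= xc andbT.
    rewrite ler_pdivrMr// mulrC -ler_pdivrMr//; apply/ltW.
    by apply: (lt_trans (truncnS_gt _)); rewrite ltr_nat.
  move=> [k _]; rewrite /F/= in_itv/= => /andP[ckx ->]; rewrite andbT.
  by apply: lt_le_trans ckx; rewrite divr_gt0.
have mpow : measurable_fun setT (fun x : R => (x `^ (p - 1))%:E).
  by apply/measurable_EFinP; exact: measurable_powR.
have cvgF : (\int[mu]_(x in F k) (x `^ (p - 1))%:E)%E @[k --> \oo] -->
    (\int[mu]_(x in `]0%R, c]) (x `^ (p - 1))%:E)%E.
  rewrite FE; apply: ge0_nondecreasing_set_cvg_integral => //.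
  - apply/nondecreasing_seqP => k; apply/subsetPset; apply: subset_itvr.
    rewrite bnd_simp ler_pM2l// lef_pV2 ?posrE//.
    by rewrite ler_nat.
  - by move=> i; exact: measurable_itv.
  - by move=> i; exact: measurable_funS mpow.
  - by move=> i x _; rewrite lee_fin powR_ge0.
rewrite -(cvg_lim _ cvgF)//.
have -> : (fun k => \int[mu]_(x in F k) (x `^ (p - 1))%:E)%E =
    EFin \o (fun k => (c `^ p - (c / k.+2%:R) `^ p) / p).
  apply/funext => k; rewrite integral_powR_itvcc ?gt_eqF ?divr_gt0//.
  by rewrite gtr_pMr// invf_lt1// ltr1n.
apply/cvg_lim => //; apply: cvg_EFin; first by near=> k.
apply: cvgMl; rewrite -[X in _ --> X]subr0.
apply: cvgB; first exact: cvg_cst.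
have /cvg_at_rightP := @powR_cvg0 R p p0; apply; split.
  by move=> k; rewrite divr_gt0.
rewrite -(mulr0 c); apply: cvgMr.
by have := @cvg_harmonic R; rewrite -cvg_shiftS.
Unshelve. all: by end_near.
Qed.

End halfline.

(** * The Gamma function *)

Section gamma.
Context {R : realType}.
Local Notation mu := (@lebesgue_measure R).
Local Notation pos := (`]0%R, +oo[%classic : set R).

Lemma gamma_integrand_lty (p : R) : 0 < p ->
  (\int[mu]_(t in pos) (t `^ (p - 1) * expR (- t))%:E < +oo)%E.
Proof.
move=> p0.
(* For t >= 1 the bound p - 1 <= n + 1 gives t^(p-1) <= t^(n+1), and one term of the series of
   exp(t/2) gives t^(n+1) <= K exp(t/2). The tail is thus dominated by K exp(-t/2), which is 2 K
   times the exponential density of rate 1/2. *)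
pose n := Num.truncn p.
pose K : R := 2 ^+ n.+1 * n.+1`!%:R.
have K0 : 0 <= K by rewrite mulr_ge0// exprn_ge0.
have mf : measurable_fun setT (fun t : R => (t `^ (p - 1) * expR (- t))%:E).
  by apply/measurable_EFinP; apply: measurable_funM;
    [exact: measurable_powR|exact: measurableT_comp].
have -> : pos = `]0%R, 1%R] `|` `]1%R, +oo[.
  by rewrite -itv_bndbnd_setU// bnd_simp.
rewrite ge0_integral_setU//=; last 3 first.
- exact: measurable_funS mf.
- by move=> t _; rewrite lee_fin mulr_ge0 ?powR_ge0 ?expR_ge0.
- rewrite disj_set2E; apply/eqP/seteqP; split => // t /=; rewrite !in_itv/= andbT.
  by move=> [/andP[_ t1]]; rewrite ltNge t1.
apply: lte_add_pinfty.
  apply: (@le_lt_trans _ _ (\int[mu]_(t in `]0%R, 1%R]) (t `^ (p - 1))%:E)%E).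
    apply: ge0_le_integral => //.
    - by move=> t _; rewrite lee_fin mulr_ge0 ?powR_ge0 ?expR_ge0.
    - exact: measurable_funS mf.
    - by apply: measurable_funTS; apply/measurable_EFinP; exact: measurable_powR.
    - move=> t /=; rewrite in_itv/= => /andP[t0 _].
      by rewrite lee_fin ler_piMr ?powR_ge0// -expR0 ler_expR oppr_le0 ltW.
  by rewrite integral_powR_itv0c// ltry.
have mpdf : measurable_fun setT (fun t : R => (exponential_pdf 2^-1 t)%:E).
  by apply/measurable_EFinP; exact: measurable_exponential_pdf.
apply: (@le_lt_trans _ _ (\int[mu]_(t in `]1%R, +oo[)
    ((K * 2)%:E * (exponential_pdf 2^-1 t)%:E))%E).
  apply: ge0_le_integral => //.
  - by move=> t _; rewrite lee_fin mulr_ge0 ?powR_ge0 ?expR_ge0.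
  - exact: measurable_funS mf.
  - by apply: measurable_funeM; apply: measurable_funTS.
  - move=> t /=; rewrite in_itv/= andbT => t1.
    have t0 : 0 < t by exact: lt_trans t1.
    rewrite -EFinM lee_fin (exponential_pdfE _ (ltW t0)).
    rewrite mulrA -[_ * 2 / 2]mulrA divff// mulr1.
    have -> : - t = t / 2 * -1 + - 2^-1 * t by field.
    rewrite expRD mulrA ler_wpM2r ?expR_ge0// mulrN1 expRN ler_pdivrMr ?expR_gt0//.
    apply: (@le_trans _ _ (t ^+ n.+1)).
      rewrite -(powR_mulrn _ (ltW t0)); apply: ler_powR; first exact: ltW.
      by rewrite lerBlDr (le_trans (ltW (truncnS_gt _)))// lerDl.
    have e_ge : (t / 2) ^+ n.+1 / n.+1`!%:R <= expR (t / 2).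
      by apply: le_trans (expR_ge1Dxn n (divr_ge0 (ltW t0) _)); rewrite ?lerDr.
    rewrite -ler_pdivrMl ?mulr_gt0 ?exprn_gt0 ?ltr0n ?fact_gt0//.
    by apply: le_trans e_ge; rewrite expr_div_n invfM mulrC mulrA mulrC mulrA.
rewrite ge0_integralZl_EFin//; last 3 first.
- by move=> t _; rewrite lee_fin exponential_pdf_ge0.
- exact: measurable_funTS.
- by rewrite mulr_ge0.
rewrite lte_mul_pinfty//; first by rewrite lee_fin mulr_ge0.
apply: (@le_lt_trans _ _ (\int[mu]_t (exponential_pdf 2^-1 t)%:E)%E).
  by apply: ge0_subset_integral => // t _; rewrite lee_fin exponential_pdf_ge0.
by rewrite integral_exponential_pdf// ltry.
Qed.

Lemma integral_Gamma (p : R) : 0 < p ->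
  (\int[mu]_(t in pos) (t `^ (p - 1) * expR (- t))%:E = (Gamma p)%:E)%E.
Proof.
move=> p0; rewrite /Gamma /Rintegral fineK// ge0_fin_numE ?gamma_integrand_lty//.
by apply: integral_ge0 => t _; rewrite lee_fin mulr_ge0 ?powR_ge0 ?expR_ge0.
Qed.

Lemma Gamma_gt0 (p : R) : 0 < p -> 0 < Gamma p.
Proof.
move=> p0; rewrite -lte_fin -integral_Gamma//.
have mf : measurable_fun setT (fun t : R => (t `^ (p - 1) * expR (- t))%:E).
  by apply/measurable_EFinP; apply: measurable_funM;
    [exact: measurable_powR|exact: measurableT_comp].
(* On [1, 2] the integrand is at least exp(-t)/t, because p - 1 >= -1, hence at least exp(-2)/2. *)
apply: (@lt_le_trans _ _ (\int[mu]_(t in `[1%R, 2%R]) (cst (expR (- 2) / 2)%:E t))%E).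
  rewrite integral_cst//= lebesgue_measure_itv/= lte_fin ltr1n -EFinB -EFinM lte_fin.
  by rewrite !mulr_gt0 ?expR_gt0// subr_gt0 ltr1n.
apply: (@le_trans _ _ (\int[mu]_(t in `[1%R, 2%R]) (t `^ (p - 1) * expR (- t))%:E)%E).
  apply: ge0_le_integral => //.
  - by move=> t _; rewrite lee_fin mulr_ge0 ?expR_ge0.
  - exact: measurable_funTS.
  - move=> t /=; rewrite in_itv/= => /andP[t1 t2].
    have t0 : 0 < t by exact: lt_le_trans t1.
    rewrite lee_fin mulrC ler_pM ?expR_ge0//; last by rewrite ler_expR lerN2.
    apply: (@le_trans _ _ (t `^ (- 1))).
      by rewrite (powR_inv1 (ltW t0)) lef_pV2 ?posrE.
    by apply: ler_powR => //; lra.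
apply: ge0_subset_integral => //.
- exact: measurable_funTS.
- by move=> t _; rewrite lee_fin mulr_ge0 ?powR_ge0 ?expR_ge0.
- by move=> t /=; rewrite !in_itv/= andbT => /andP[t1 _]; exact: lt_le_trans t1.
Qed.

Lemma integral_gamma_scale (p c : R) : 0 < p -> 0 < c ->
  (\int[mu]_(t in pos) (t `^ (p - 1) * expR (- (c * t)))%:E =
   (Gamma p * c `^ (- p))%:E)%E.
Proof.
move=> p0 c0.
have mf : measurable_fun setT (fun t : R => (t `^ (p - 1) * expR (- t))%:E).
  by apply/measurable_EFinP; apply: measurable_funM;
    [exact: measurable_powR|exact: measurableT_comp].
have mg : measurable_fun setT (fun t : R => (t `^ (p - 1) * expR (- (c * t)))%:E).
  apply/measurable_EFinP; apply: measurable_funM; first exact: measurable_powR.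
  by apply: measurableT_comp => //; apply: measurableT_comp => //; exact: measurable_funM.
transitivity (\int[mu]_(t in pos) ((c `^ (1 - p))%:E *
    ((c * t) `^ (p - 1) * expR (- (c * t)))%:E))%E.
  apply: eq_integral => t; rewrite inE/= in_itv/= andbT => t0.
  rewrite -EFinM (powRM _ (ltW c0) (ltW t0)) !mulrA -gt0_powRD//.
  by have -> : 1 - p + (p - 1) = 0; [ring|rewrite powRr0 mul1r].
rewrite ge0_integralZl_EFin ?powR_ge0//; last 2 first.
- by move=> t _; rewrite lee_fin mulr_ge0 ?powR_ge0 ?expR_ge0.
- apply: measurable_funTS; apply: (measurableT_comp mf).
  exact: measurable_funM.
rewrite (ge0_integral_scale (fun t => (t `^ (p - 1) * expR (- t))%:E))//; last first.
  by move=> t; rewrite lee_fin mulr_ge0 ?powR_ge0 ?expR_ge0.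
rewrite integral_Gamma// -!EFinM; congr EFin.
rewrite mulrA mulrC; congr (_ * _); rewrite -(powR_inv1 (ltW c0)).
by rewrite -gt0_powRD//; congr (_ `^ _); ring.
Qed.

Lemma integral_gammaB (p a b : R) : 0 < p -> 0 < a -> a <= b ->
  (\int[mu]_(t in pos) (t `^ (p - 1) * (expR (- (a * t)) - expR (- (b * t))))%:E =
   (Gamma p * (a `^ (- p) - b `^ (- p)))%:E)%E.
Proof.
move=> p0 a0 ab; have b0 : 0 < b by exact: lt_le_trans ab.
have mg c : measurable_fun setT (fun t : R => (t `^ (p - 1) * expR (- (c * t)))%:E).
  apply/measurable_EFinP; apply: measurable_funM; first exact: measurable_powR.
  by apply: measurableT_comp => //; apply: measurableT_comp => //; exact: measurable_funM.
have ig c : 0 < c -> mu.-integrable pos (fun t : R => (t `^ (p - 1) * expR (- (c * t)))%:E).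
  move=> c0; apply/integrableP; split; first by apply: measurable_funTS; exact: mg.
  under eq_integral => t _ do rewrite gee0_abs ?lee_fin ?mulr_ge0 ?powR_ge0 ?expR_ge0//.
  by rewrite integral_gamma_scale// ltry.
under eq_integral => t _ do rewrite mulrBr EFinB.
by rewrite integralB_EFin ?ig// !integral_gamma_scale// -EFinB mulrBr.
Qed.

End gamma.

(** * Tonelli's theorem on subdomains *)

Section tonelli_on.
Local Open Scope ereal_scope.
Context {d1 d2 : measure_display} {T1 : measurableType d1} {T2 : measurableType d2}.
Context {R : realType}.
Context (m1 : {sigma_finite_measure set T1 -> \bar R}).
Context (m2 : {sigma_finite_measure set T2 -> \bar R}).
Context (D1 : set T1) (D2 : set T2) (f : T1 * T2 -> \bar R).
Context (mD1 : measurable D1) (mD2 : measurable D2).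
Context (mf : measurable_fun (D1 `*` D2) f).
Context (f0 : forall x y, D1 x -> D2 y -> 0 <= f (x, y)).

Let g : T1 * T2 -> \bar R := f \_ (D1 `*` D2).

Let mg : measurable_fun setT g.
Proof. exact: (measurable_restrictT _ (measurableX mD1 mD2)).1. Qed.

Let g0 x : 0 <= g x.
Proof. by apply: erestrict_ge0 => -[y z] [] /=; exact: f0. Qed.

Let gE1 x : D1 x -> (fun y => g (x, y)) = (fun y => f (x, y)) \_ D2.
Proof.
by move=> Dx; apply/funext => y; rewrite /g !patchE in_setX (mem_set Dx).
Qed.

Let gE2 y : D2 y -> (fun x => g (x, y)) = (fun x => f (x, y)) \_ D1.
Proof.
by move=> Dy; apply/funext => x; rewrite /g !patchE in_setX (mem_set Dy) andbT.
Qed.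

Lemma measurable_fun_integral_on :
  measurable_fun D1 (fun x => \int[m2]_(y in D2) f (x, y)).
Proof.
have := measurable_funTS (D := D1) (@measurable_fun_fubini_tonelli_F _ _ _ _ _ m2 _ mg g0).
apply: eq_measurable_fun => x; rewrite inE => Dx.
by rewrite /fubini_F gE1// -integral_mkcond.
Qed.

Lemma tonelli_on :
  \int[m1]_(x in D1) \int[m2]_(y in D2) f (x, y) =
  \int[m2]_(y in D2) \int[m1]_(x in D1) f (x, y).
Proof.
transitivity (\int[m1]_x \int[m2]_y g (x, y)).
  rewrite [LHS]integral_mkcond; apply: eq_integral => x _; rewrite patchE.
  case: ifPn => [|/negP]; rewrite inE => Dx; first by rewrite gE1// -integral_mkcond.
  by rewrite integral0_eq// => y _; rewrite /g patchE in_setX memNset.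
transitivity (\int[m2]_y \int[m1]_x g (x, y)).
  by have := @fubini_tonelli _ _ _ _ _ m1 m2 _ mg g0; rewrite /fubini_F /fubini_G.
rewrite [RHS]integral_mkcond; apply: eq_integral => y _; rewrite patchE.
case: ifPn => [|/negP]; rewrite inE => Dy; first by rewrite gE2// -integral_mkcond.
by rewrite integral0_eq// => x _; rewrite /g patchE in_setX (memNset Dy) andbF.
Qed.

End tonelli_on.

(** * Regularised Gamma and Beta integrals *)

Section beta_type_integral.
Context {R : realType}.
Local Notation mu := (@lebesgue_measure R).
Local Notation pos := (`]0%R, +oo[%classic : set R).

Lemma is_derive_expRNM (r x : R) : 
  is_derive x 1 (fun x => expR (- (r * x))) (- r * expR (- (r * x))).
Proof.
have dl : is_derive x 1 (fun x : R => - (r * x)) (- r).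
  apply: is_derive_eq.
  by rewrite scaler1.
apply: (is_derive_eq (is_derive1_comp (is_derive_expR _) dl)).
by rewrite mulrC.
Qed.

Lemma integral_expR_itv0c (r c : R) : 0 < r -> 0 < c ->
  (\int[mu]_(x in `]0%R, c]) (expR (- (r * x)))%:E = ((1 - expR (- (r * c))) / r)%:E)%E.
Proof.
move=> r0 c0.
have dF (x : R) : is_derive x 1 (fun x => - expR (- (r * x)) / r) (expR (- (r * x))).
  have -> : (fun x => - expR (- (r * x)) / r) = (- r^-1) \*: (fun x => expR (- (r * x))).
    by apply/funext => z /=; rewrite mulrC mulrN -mulNr.
  apply: (is_derive_eq (is_deriveZ _ (is_derive_expRNM r x))).
  by rewrite /GRing.scale/=; field; rewrite gt_eqF.
have cF : continuous (fun x : R => - expR (- (r * x)) / r).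
  move=> x; apply/differentiable_continuous/derivable1_diffP.
  by have [] := dF x.
have ce : continuous (fun x : R => expR (- (r * x))).
  move=> x; apply/differentiable_continuous/derivable1_diffP.
  by have [] := is_derive_expRNM r x.
rewrite integral_itv_obnd_cbnd; last first.
  by apply/measurable_EFinP/measurable_funTS; exact: continuous_measurable_fun.
rewrite (@continuous_FTC2 _ _ (fun x => - expR (- (r * x)) / r))//.
- by rewrite mulr0 oppr0 expR0 -EFinB; congr EFin; field; rewrite gt_eqF.
- exact: continuous_subspaceT.
- split.
  + by move=> x _; have [] := dF x.
  + by apply/cvg_at_right_filter/cF.
  + by apply/cvg_at_left_filter/cF.
- by move=> x _; rewrite derive1E; have [_ ->] := dF x.
Qed.

(** Classically the value is -Gamma(-s) c^s. Writing 1 - exp(-c t) as t times the integral of exp(-l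
    t) over l in (0, c] raises the power of t to -s, which is integrable at 0 because s < 1; the
    l^(s-1) left over is integrable at 0 because s > 0. *)
Lemma integral_powR_1BexpR (s c : R) : 0 < s -> s < 1 -> 0 < c ->
  (\int[mu]_(t in pos) (t `^ (- s - 1) * (1 - expR (- (c * t))))%:E =
   (Gamma (1 - s) * c `^ s / s)%:E)%E.
Proof.
move=> s0 s1 c0.
pose f (tl : R * R) := (tl.1 `^ (- s) * expR (- (tl.2 * tl.1)))%:E.
have f0 t l : (0 <= f (t, l))%E by rewrite lee_fin mulr_ge0 ?powR_ge0 ?expR_ge0.
have mf : measurable_fun setT f.
  apply/measurable_EFinP; apply: measurable_funM.
    apply: (measurableT_comp (measurable_powR _)); exact: measurable_fst.
  apply: measurable_expRN.
  by apply: measurable_funM; [exact: measurable_snd|exact: measurable_fst].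
transitivity (\int[mu]_(t in pos) \int[mu]_(l in `]0%R, c]) f (t, l))%E.
  apply: eq_integral => t; rewrite inE/= in_itv/= andbT => t0.
  rewrite /f/=; under eq_integral => l _ do rewrite EFinM mulrC.
  rewrite ge0_integralZl_EFin ?powR_ge0//; last first.
    apply: measurable_funTS; apply/measurable_EFinP; apply: measurable_expRN.
    exact: measurable_funM.
  rewrite integral_expR_itv0c// -EFinM; congr EFin.
  by rewrite gt0_powRD// (powR_inv1 (ltW t0)) [c * t]mulrC mulrAC mulrA.
rewrite tonelli_on//; last exact: measurable_funTS.
transitivity (\int[mu]_(l in `]0%R, c]) ((Gamma (1 - s))%:E * (l `^ (s - 1))%:E))%E.
  apply: eq_integral => l; rewrite inE/= in_itv/= => /andP[l0 _].
  rewrite /f/= -EFinM.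
  have -> : s - 1 = - (1 - s) by ring.
  rewrite -integral_gamma_scale; [|by rewrite subr_gt0|exact: l0].
  apply: eq_integral => t _.
  by congr (_ `^ _ * _)%:E; ring.
rewrite ge0_integralZl_EFin//; last 3 first.
- by move=> l _; rewrite lee_fin powR_ge0.
- by apply: measurable_funTS; apply/measurable_EFinP; exact: measurable_powR.
- by rewrite ltW// Gamma_gt0// subr_gt0.
by rewrite integral_powR_itv0c// -EFinM mulrA.
Qed.

(** Against w^(m+s-1) each power alone leaves a tail w^(s-1) and diverges; the difference gains a
    factor 1/w, enough since s < 1. Representing both powers by Gamma integrals in t turns the
    difference into a factor 1 - exp(-h t), after which the w-integral is a Gamma integral and the
    t-integral is [integral_powR_1BexpR]. *)
Lemma integral_powR_beta (m s D h : R) : 0 < m -> 0 < s -> s < 1 -> 0 < D -> 0 < h ->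
  (\int[mu]_(w in pos) (w `^ (m + s - 1) * ((w * D) `^ (- m) - (h + w * D) `^ (- m)))%:E =
   (Gamma (m + s) * Gamma (1 - s) / (s * Gamma m) * D `^ (- (m + s)) * h `^ s)%:E)%E.
Proof.
move=> m0 s0 s1 D0 h0; have Gm0 := Gamma_gt0 _ m0.
have ms0 : 0 < m + s by rewrite addr_gt0.
pose f (wt : R * R) := (wt.1 `^ (m + s - 1) * (wt.2 `^ (m - 1) *
  (expR (- (wt.1 * D * wt.2)) - expR (- ((h + wt.1 * D) * wt.2)))))%:E.
have f0 w t : pos w -> pos t -> (0 <= f (w, t))%E.
  rewrite /= !in_itv/= !andbT => w0 t0; rewrite lee_fin !mulr_ge0 ?powR_ge0//.
  by rewrite subr_ge0 ler_expR lerN2 mulrDl lerDr mulr_ge0 ?ltW.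
have mf : measurable_fun setT f.
  apply/measurable_EFinP; apply: measurable_funM.
    apply: (measurableT_comp (measurable_powR _)); exact: measurable_fst.
  apply: measurable_funM.
    apply: (measurableT_comp (measurable_powR _)); exact: measurable_snd.
  apply: measurable_funB; apply: measurable_expRN.
    apply: measurable_funM; last exact: measurable_snd.
    by apply: measurable_funM => //; exact: measurable_fst.
  apply: measurable_funM; last exact: measurable_snd.
  apply: measurable_funD => //.
  by apply: measurable_funM => //; exact: measurable_fst.
transitivity (\int[mu]_(w in pos) ((Gamma m)^-1%:E * \int[mu]_(t in pos) f (w, t)))%E.
  apply: eq_integral => w; rewrite inE/= in_itv/= andbT => w0.
  rewrite /f/=; under eq_integral => t _ do rewrite EFinM.
  rewrite ge0_integralZl_EFin ?powR_ge0//; last 2 first.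
  - move=> t /=; rewrite in_itv/= andbT => t0.
    rewrite lee_fin !mulr_ge0 ?powR_ge0//.
    by rewrite subr_ge0 ler_expR lerN2 mulrDl lerDr mulr_ge0 ?ltW.
  - apply: measurable_funTS; apply/measurable_EFinP; apply: measurable_funM.
      exact: measurable_powR.
    by apply: measurable_funB; apply: measurable_expRN; exact: measurable_funM.
  rewrite integral_gammaB ?mulr_gt0//; last by rewrite lerDr ltW.
  by rewrite -!EFinM; congr EFin; field; rewrite gt_eqF.
rewrite ge0_integralZl_EFin; last 4 first.
- by [].
- move=> w w0; apply: integral_ge0 => t t0; exact: f0.
- by apply: measurable_fun_integral_on => //; exact: measurable_funTS.
- by rewrite invr_ge0 ltW.
rewrite tonelli_on//; last exact: measurable_funTS.
transitivity ((Gamma m)^-1%:E * \int[mu]_(t in pos)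
   ((Gamma (m + s) * D `^ (- (m + s)))%:E * (t `^ (- s - 1) * (1 - expR (- (h * t))))%:E))%E.
  congr (_ * _)%E; apply: eq_integral => t; rewrite inE/= in_itv/= andbT => t0.
  transitivity (\int[mu]_(w in pos) ((t `^ (m - 1) * (1 - expR (- (h * t))))%:E *
      (w `^ (m + s - 1) * expR (- ((D * t) * w)))%:E))%E.
    apply: eq_integral => w _; rewrite /f/= -EFinM; congr EFin.
    have -> : - (w * D * t) = - (D * t * w) by ring.
    have -> : - ((h + w * D) * t) = - (h * t) + - (D * t * w) by ring.
    by rewrite expRD; ring.
  rewrite ge0_integralZl_EFin//; last 3 first.
  - by move=> w _; rewrite lee_fin mulr_ge0 ?powR_ge0 ?expR_ge0.
  - apply: measurable_funTS; apply/measurable_EFinP; apply: measurable_funM.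
      exact: measurable_powR.
    by apply: measurable_expRN; exact: measurable_funM.
  - by rewrite mulr_ge0 ?powR_ge0// subr_ge0 -expR0 ler_expR oppr_le0 mulr_ge0 ?ltW.
  rewrite integral_gamma_scale ?mulr_gt0// -!EFinM; congr EFin.
  rewrite (powRM _ (ltW D0) (ltW t0)).
  have -> : - s - 1 = (m - 1) + - (m + s) by ring.
  by rewrite (gt0_powRD _ (m - 1))//; ring.
rewrite ge0_integralZl_EFin//; last 3 first.
- move=> t /=; rewrite in_itv/= andbT => t0; rewrite lee_fin mulr_ge0 ?powR_ge0//.
  by rewrite subr_ge0 -expR0 ler_expR oppr_le0 mulr_ge0 ?ltW.
- apply: measurable_funTS; apply/measurable_EFinP; apply: measurable_funM.
    exact: measurable_powR.
  by apply: measurable_funB => //; apply: measurable_expRN; exact: measurable_funM.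
- exact: mulr_ge0 (ltW (Gamma_gt0 _ ms0)) (powR_ge0 _ _).
rewrite (integral_powR_1BexpR _ _ s0 s1 h0) -!EFinM; congr EFin.
have alg (u v p r k : R) : k != 0 -> k^-1 * (u * p * (v * r / s)) = u * v / (s * k) * p * r.
  by move=> k0; field; rewrite k0 gt_eqF.
exact: alg (lt0r_neq0 Gm0).
Qed.

End beta_type_integral.

(** * Gaussian integrals *)

Section gauss.
Context {R : realType}.
Local Notation mu := (@lebesgue_measure R).
Local Open Scope ereal_scope.

(** This is the normal density of mean [m] and variance 1/(2c) with its peak divided out. *)
Lemma integral_gauss1 (c m : R) : (0 < c)%R ->
  \int[mu]_x (expR (- (c * (x - m) ^+ 2)))%:E = ((pi / c) `^ 2^-1)%:E.
Proof.
move=> c0.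
pose sg : R := ((c *+ 2) `^ (- 2^-1))%R.
have c20 : (0 < c *+ 2)%R by rewrite pmulrn_lgt0.
have sg0 : sg != 0%R by rewrite gt_eqF// powR_gt0.
have sg2 : (sg ^+ 2 = (c *+ 2)^-1)%R.
  rewrite -powR_mulrn ?powR_ge0// -powRrM -(powR_inv1 (ltW c20)); congr (_ `^ _)%R.
  by field.
have := integral_normal_pdf m sg; rewrite normal_pdfE//.
under eq_integral => x _ do rewrite EFinM.
rewrite ge0_integralZl_EFin//; last 3 first.
- by move=> x _; rewrite lee_fin normal_fun_ge0.
- by apply/measurable_EFinP; exact: measurable_normal_fun.
- exact: normal_peak_ge0.
have -> : \int[mu]_x (normal_fun m sg x)%:E = \int[mu]_x (expR (- (c * (x - m) ^+ 2)))%:E.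
  apply: eq_integral => x _; rewrite /normal_fun; congr (expR _)%:E.
  by rewrite sg2; field; rewrite gt_eqF.
rewrite /normal_peak sg2.
set I := \int[mu]_x _ => H.
have -> : ((pi / c) `^ 2^-1 = Num.sqrt ((c *+ 2)^-1 * pi *+ 2))%R.
  rewrite powR12_sqrt; last by rewrite divr_ge0 ?pi_ge0// ltW.
  by congr Num.sqrt; field; rewrite gt_eqF.
set q := Num.sqrt _ in H *.
have q0 : (0 < q)%R.
  by rewrite sqrtr_gt0 mulrn_wgt0// mulr_gt0 ?pi_gt0// invr_gt0.
have := congr1 (fun z => q%:E * z) H; rewrite muleA -EFinM divff ?gt_eqF// mul1e mule1.
by [].
Qed.

Lemma ge0_integral_lebesgue_tupleS (n : nat) (f : n.+1.-tuple (measurableTypeR R) -> \bar R) :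
  measurable_fun setT f -> (forall t, 0 <= f t) ->
  \int[lebesgue_tuple R n.+1]_t f t =
  \int[mu]_x \int[lebesgue_tuple R n]_t f [tuple of x :: t].
Proof.
move=> mf f0.
have mc := @measurable_tuple_cons R n.
transitivity (\int[mu \x lebesgue_tuple R n]_p f (tuple_cons p)).
  rewrite -[RHS](@ge0_integral_pushforward _ _ _ _ _ _ mc (mu \x lebesgue_tuple R n) setT f)//.
rewrite fubini_tonelli1//.
exact: measurableT_comp.
Qed.

Lemma measurable_sum_sqrB (n : nat) (m : 'I_n -> R) :
  measurable_fun setT (fun t : n.-tuple (measurableTypeR R) =>
    (\sum_(i < n) (tnth t i - m i) ^+ 2)%R).
Proof.
apply: measurable_sum => i; apply: measurable_funX; apply: measurable_funB => //.
exact: measurable_tnth.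
Qed.

Lemma measurable_gauss_tuple (n : nat) (c : R) (m : 'I_n -> R) :
  measurable_fun setT (fun t : n.-tuple (measurableTypeR R) =>
    (expR (- (c * \sum_(i < n) (tnth t i - m i) ^+ 2)))%:E).
Proof.
apply/measurable_EFinP/measurable_expRN; apply: measurable_funM => //.
exact: measurable_sum_sqrB.
Qed.

Lemma integral_gauss_tuple (n : nat) (c : R) (m : 'I_n -> R) : (0 < c)%R ->
  \int[lebesgue_tuple R n]_t
    (expR (- (c * \sum_(i < n) (tnth t i - m i) ^+ 2)))%:E =
  ((pi / c) `^ (n%:R / 2))%:E.
Proof.
move=> c0; elim: n m => [|n IH] m.
  rewrite /= integral_dirac//; last exact: measurable_gauss_tuple.
  rewrite diracE mem_set// mul1e big_ord0 mulr0 oppr0 expR0 mul0r powRr0.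
  by [].
rewrite [LHS](ge0_integral_lebesgue_tupleS n (fun t : n.+1.-tuple (measurableTypeR R) =>
  (expR (- (c * \sum_(i < n.+1) (tnth t i - m i) ^+ 2)))%:E)); last 2 first.
- exact: measurable_gauss_tuple.
- by move=> t; rewrite lee_fin expR_ge0.
pose m' i := m (lift ord0 i).
transitivity (\int[mu]_x ((expR (- (c * (x - m ord0) ^+ 2)))%:E *
    ((pi / c) `^ (n%:R / 2))%:E)).
  apply: eq_integral => x _; rewrite -(IH m').
  rewrite -ge0_integralZl_EFin ?expR_ge0//; last exact: measurable_gauss_tuple.
  apply: eq_integral => t _; rewrite -EFinM -expRD; congr (expR _)%:E.
  rewrite big_ord_recl tnth0.
  under eq_bigr => i _ do rewrite tnthS.
  by rewrite mulrDr opprD.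
under eq_integral => x _ do rewrite muleC.
rewrite ge0_integralZl_EFin ?powR_ge0//; last first.
  apply/measurable_EFinP/measurable_expRN; apply: measurable_funM => //.
  by apply: measurable_funX; exact: measurable_funB.
rewrite integral_gauss1// -EFinM -gt0_powRD ?divr_gt0 ?pi_gt0//; congr (_ `^ _)%:E.
by rewrite -natr1; field.
Qed.

End gauss.

(** * Subordination to Gaussians *)

Section fin_integral.
Context {R : realType} {d : measure_display} {T : measurableType d}.
Context (nu : {measure set T -> \bar R}) (D : set T).
Context (mD : measurable D).
Implicit Types f g h : T -> R.

Lemma ge0_integrable_fin f (I : R) : measurable_fun D f ->
  (forall x, D x -> 0 <= f x) -> (\int[nu]_(x in D) (f x)%:E = I%:E)%E ->
  nu.-integrable D (EFin \o f).
Proof.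
move=> mf f0 fI; apply/integrableP; split; first exact/measurable_EFinP.
rewrite (eq_integral (fun x => (f x)%:E)) ?fI ?ltry// => x /[!inE] Dx.
by rewrite gee0_abs// lee_fin f0.
Qed.

(** For a nonnegative function a finite value of the integral is already a proof of integrability,
    so the computed values themselves license the subtraction. *)
Lemma ge0_integralB_fin f g (I J : R) :
  measurable_fun D f -> (forall x, D x -> 0 <= f x) ->
  measurable_fun D g -> (forall x, D x -> 0 <= g x) ->
  (\int[nu]_(x in D) (f x)%:E = I%:E)%E -> (\int[nu]_(x in D) (g x)%:E = J%:E)%E ->
  (\int[nu]_(x in D) (f x - g x)%:E = (I - J)%:E)%E.
Proof.
move=> mf f0 mg g0 fI gJ; rewrite EFinB -fI -gJ -integralB_EFin//.
- exact: ge0_integrable_fin fI.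
- exact: ge0_integrable_fin gJ.
Qed.

Lemma ge0_integralDB_fin f g h (I J K : R) :
  measurable_fun D f -> (forall x, D x -> 0 <= f x) ->
  measurable_fun D g -> (forall x, D x -> 0 <= g x) ->
  measurable_fun D h -> (forall x, D x -> 0 <= h x) ->
  (\int[nu]_(x in D) (f x)%:E = I%:E)%E -> (\int[nu]_(x in D) (g x)%:E = J%:E)%E ->
  (\int[nu]_(x in D) (h x)%:E = K%:E)%E ->
  (\int[nu]_(x in D) (f x + g x - 2 * h x)%:E = (I + J - 2 * K)%:E)%E.
Proof.
move=> mf f0 mg g0 mh h0 fI gJ hK.
apply: (ge0_integralB_fin (fun x => f x + g x) (fun x => 2 * h x)).
- exact: measurable_funD.
- by move=> x Dx; rewrite addr_ge0 ?f0 ?g0.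
- exact: measurable_funM.
- by move=> x Dx; rewrite mulr_ge0 ?h0.
- under eq_integral => x _ do rewrite EFinD.
  rewrite ge0_integralD//=; first by rewrite fI gJ.
  + exact/measurable_EFinP.
  + exact/measurable_EFinP.
- under eq_integral => x _ do rewrite EFinM.
  rewrite ge0_integralZl_EFin//; first by rewrite hK.
  exact/measurable_EFinP.
Qed.

End fin_integral.

Section subordination.
Context {R : realType} {d : measure_display} {T : measurableType d}.
Context (nu : {sigma_finite_measure set T -> \bar R}).
Local Notation mu := (@lebesgue_measure R).
Local Notation pos := (`]0%R, +oo[%classic : set R).
(** [q] plays the role of |z|^2, and [psi] that of a signed combination of exponentials whose Gamma
    integral in t is the numerator [N]. Both parts of the second difference are instances. *)
Context (q : T -> R) (psi : T -> R -> R) (N : T -> R) (a b : R).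
Context (a0 : 0 < a) (b0 : 0 < b).
Context (mq : measurable_fun setT q) (q0 : forall z, 0 <= q z).
Context (mpsi : measurable_fun setT (fun zt : T * R => psi zt.1 zt.2)).
Context (psi0 : forall z t, 0 < t -> 0 <= psi z t).
Context (psi_eq0 : forall z t, q z = 0 -> psi z t = 0).
Context (NE : forall z,
  (\int[mu]_(t in pos) (t `^ (a - 1) * psi z t)%:E = (Gamma a * N z)%:E)%E).

(** The exponent a + b - 1 collects t^(a-1) from the numerator and t^b from the scaled kernel. *)
Let phi (ztw : T * R * R) : \bar R :=
  (ztw.2 `^ (b - 1) * ztw.1.2 `^ (a + b - 1) *
   (psi ztw.1.1 ztw.1.2 * expR (- (ztw.1.2 * ztw.2 * q ztw.1.1))))%:E.

Let phi_ge0 z t w : pos t -> (0 <= phi (z, t, w))%E.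
Proof.
rewrite /= in_itv/= andbT => t0.
by rewrite lee_fin !mulr_ge0 ?powR_ge0 ?expR_ge0 ?psi0.
Qed.

Let mphi : measurable_fun setT phi.
Proof.
have m1 : measurable_fun setT (fun ztw : T * R * R => ztw.1.1).
  exact: (measurableT_comp measurable_fst measurable_fst).
have m2 : measurable_fun setT (fun ztw : T * R * R => ztw.1.2).
  exact: (measurableT_comp measurable_snd measurable_fst).
have m3 : measurable_fun setT (fun ztw : T * R * R => ztw.2).
  exact: measurable_snd.
apply/measurable_EFinP; apply: measurable_funM.
  by apply: measurable_funM; apply: (measurableT_comp (measurable_powR _)).
apply: measurable_funM.
  exact: (measurableT_comp mpsi measurable_fst).
apply: measurable_expRN; apply: measurable_funM; first exact: measurable_funM.
exact: measurableT_comp mq m1.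
Qed.

Let phi_int z :
  (\int[mu]_(t in pos) \int[mu]_(w in pos) phi (z, t, w) =
   (Gamma a * Gamma b * (N z / q z `^ b))%:E)%E.
Proof.
(* Where [q] vanishes the quotient is 0 by the convention on inverses, and [psi_eq0] makes the
   double integral 0 too, so the origin need not be discarded as a null set. *)
have [qz|qz] := eqVneq (q z) 0.
  rewrite qz powR0 ?gt_eqF// invr0 !mulr0; apply: integral0_eq => t t0.
  by apply: integral0_eq => w _; rewrite /phi/= psi_eq0// mul0r mulr0.
have {}qz : 0 < q z by rewrite lt_neqAle eq_sym qz q0.
have mpz : measurable_fun setT (psi z).
  by have := measurableT_comp mpsi (pair1_measurable z); exact.
transitivity (\int[mu]_(t in pos) ((Gamma b * q z `^ (- b))%:E *
    (t `^ (a - 1) * psi z t)%:E))%E.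
  apply: eq_integral => t; rewrite inE/= in_itv/= andbT => t0.
  transitivity (\int[mu]_(w in pos) ((t `^ (a + b - 1) * psi z t)%:E *
     (w `^ (b - 1) * expR (- ((t * q z) * w)))%:E))%E.
    apply: eq_integral => w _; rewrite /phi/= -EFinM; congr EFin.
    by rewrite [t * w * _]mulrAC; ring.
  rewrite ge0_integralZl_EFin//; last 3 first.
  - by move=> w _; rewrite lee_fin mulr_ge0 ?powR_ge0 ?expR_ge0.
  - apply: measurable_funTS; apply/measurable_EFinP; apply: measurable_funM.
      exact: measurable_powR.
    by apply: measurable_expRN; exact: measurable_funM.
  - by rewrite mulr_ge0 ?powR_ge0 ?psi0.
  rewrite integral_gamma_scale ?mulr_gt0// -!EFinM; congr EFin.
  rewrite (powRM _ (ltW t0) (ltW qz)).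
  have -> : a - 1 = (a + b - 1) + - b by ring.
  by rewrite (gt0_powRD _ (a + b - 1))//; ring.
rewrite ge0_integralZl_EFin//; last 3 first.
- move=> t; rewrite /= in_itv/= andbT => t0.
  by rewrite lee_fin mulr_ge0 ?powR_ge0 ?psi0.
- by apply: measurable_funTS; apply/measurable_EFinP; exact: measurable_funM.
- by rewrite mulr_ge0 ?powR_ge0// ltW// Gamma_gt0.
have alg (u v c k : R) : u * v * (c * k) = c * u * (k * v) by ring.
rewrite NE -EFinM powRN; congr EFin; exact: alg.
Qed.

(** Three exchanges, each allowed by the sign of [psi], bring z to the innermost place and w to the
    outermost: z past t, z past w at fixed t, then t past w. *)
Lemma integral_subordination :
  (\int[nu]_z (N z / q z `^ b)%:E = ((Gamma a * Gamma b)^-1)%:E *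
   \int[mu]_(w in pos) \int[mu]_(t in pos)
     ((w `^ (b - 1) * t `^ (a + b - 1))%:E *
      \int[nu]_z (psi z t * expR (- (t * w * q z)))%:E))%E.
Proof.
have Gab := mulr_gt0 (Gamma_gt0 _ a0) (Gamma_gt0 _ b0).
have mphiw : measurable_fun ([set: T] `*` pos)
    (fun zt => \int[mu]_(w in pos) phi (zt, w))%E.
  apply: (measurable_fun_integral_on mu ([set: T] `*` pos) pos phi) => //.
  - exact: measurableX.
  - exact: measurable_funTS.
  - by move=> [z t] w [_ t0] _; exact: phi_ge0.
transitivity (((Gamma a * Gamma b)^-1)%:E *
    \int[nu]_z \int[mu]_(t in pos) \int[mu]_(w in pos) phi (z, t, w))%E.
  rewrite -ge0_integralZl_EFin//; last 3 first.
  - move=> z _; apply: integral_ge0 => t t0; apply: integral_ge0 => w _.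
    exact: phi_ge0.
  - apply: (measurable_fun_integral_on mu setT pos
      (fun zt => \int[mu]_(w in pos) phi (zt, w)))%E => //.
    by move=> z t _ t0; apply: integral_ge0 => w _; exact: phi_ge0.
  - by rewrite invr_ge0; exact: ltW Gab.
  apply: eq_integral => z _; by rewrite phi_int -EFinM (mulKf (lt0r_neq0 Gab)).
congr (_ * _)%E.
rewrite (tonelli_on nu mu setT pos (fun zt => \int[mu]_(w in pos) phi (zt, w))%E)//;
  last by move=> z t _ t0; apply: integral_ge0 => w _; exact: phi_ge0.
transitivity (\int[mu]_(t in pos) \int[mu]_(w in pos) \int[nu]_z phi (z, t, w))%E.
  apply: eq_integral => t; rewrite inE => t0.
  rewrite (tonelli_on nu mu setT pos (fun zw => phi (zw.1, t, zw.2)))//.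
    apply: measurable_funTS; apply: (measurableT_comp mphi).
    apply: measurable_fun_pair; last exact: measurable_snd.
    by apply: measurable_fun_pair => //; exact: measurable_fst.
  by move=> z w _ w0; exact: phi_ge0.
rewrite (tonelli_on mu mu pos pos (fun tw => \int[nu]_z phi (z, tw.1, tw.2))%E
  (measurable_itv _) (measurable_itv _)); last 2 first.
- apply: (measurable_fun_integral_on nu (pos `*` pos) setT
      (fun twz => phi (twz.2, twz.1.1, twz.1.2)))%E => //.
  + exact: measurableX.
  + apply: measurable_funTS; apply: (measurableT_comp mphi).
    apply: measurable_fun_pair; last exact: (measurableT_comp measurable_snd measurable_fst).
    apply: measurable_fun_pair; first exact: measurable_snd.
    exact: (measurableT_comp measurable_fst measurable_fst).
  + by move=> [t w] z [/= t0 w0] _; exact: phi_ge0.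
- by move=> t w t0 w0; apply: integral_ge0 => z _; exact: phi_ge0.
apply: eq_integral => w; rewrite inE => w0; apply: eq_integral => t; rewrite inE => t0.
rewrite -ge0_integralZl_EFin ?mulr_ge0 ?powR_ge0//; last 2 first.
- move: t0; rewrite /= in_itv/= andbT => t0 z _.
  by rewrite lee_fin mulr_ge0 ?expR_ge0 ?psi0.
- apply/measurable_EFinP; apply: measurable_funM.
    by have := measurableT_comp mpsi (pair2_measurable t); exact.
  by apply: measurable_expRN; exact: measurable_funM.
Qed.

End subordination.

(** * Squared Euclidean norm and completed squares *)

Section sqnorm.
Context {R : realType} {n : nat}.
Implicit Types x z : 'rV[R]_n.

Definition sqnorm z : R := \sum_(i < n) z ord0 i ^+ 2.

Lemma sqnorm_ge0 z : 0 <= sqnorm z.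
Proof. by apply: sumr_ge0 => i _; exact: sqr_ge0. Qed.

Lemma sqnorm_eq0 z : sqnorm z = 0 -> z = 0.
Proof.
move=> /eqP; rewrite psumr_eq0 => [/allP z0|i _]; last exact: sqr_ge0.
apply/rowP => i; rewrite mxE; apply/eqP.
by rewrite -sqrf_eq0; apply: z0; rewrite mem_index_enum.
Qed.

Lemma enorm_sqr z : enorm z ^+ 2 = sqnorm z.
Proof. by rewrite sqr_sqrtr// sqnorm_ge0. Qed.

Lemma enorm_powR z (r : R) : enorm z `^ r = sqnorm z `^ (r / 2).
Proof. by rewrite /enorm -powR12_sqrt ?sqnorm_ge0// -powRrM mulrC. Qed.

Lemma sqnormDB x z : sqnorm (x + z) + sqnorm (x - z) = 2 * (sqnorm x + sqnorm z).
Proof.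
rewrite /sqnorm -!big_split mulr_sumr; apply: eq_bigr => i _ /=.
by rewrite !mxE; ring.
Qed.

Lemma sqnorm_vec (t : n.-tuple (measurableTypeR R)) :
  sqnorm (vec_of_tuple t) = \sum_(i < n) (tnth t i - 0) ^+ 2.
Proof. by apply: eq_bigr => i _; rewrite mxE subr0. Qed.

(** Taking k = 1 and k = -1 treats x + z and x - z at once. Only the centre of the square depends on
    k, so both shifts lead to the same Gaussian integral. *)
Lemma sqnormD_square x (t : n.-tuple (measurableTypeR R)) (w k : R) :
  0 < w -> k ^+ 2 = 1 ->
  sqnorm (x + k *: vec_of_tuple t) + w * sqnorm (vec_of_tuple t) =
  (1 + w) * \sum_(i < n) (tnth t i - (- k * x ord0 i / (1 + w))) ^+ 2
  + w / (1 + w) * sqnorm x.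
Proof.
move=> w0 k1; rewrite /sqnorm !mulr_sumr -!big_split; apply: eq_bigr => i _ /=.
rewrite !mxE; have w1 : 1 + w != 0 by rewrite gt_eqF// addr_gt0.
transitivity (x ord0 i ^+ 2 + 2 * k * x ord0 i * tnth t i + (k ^+ 2 + w) * tnth t i ^+ 2).
  by ring.
transitivity ((1 + w) * tnth t i ^+ 2 + 2 * k * x ord0 i * tnth t i +
    (k ^+ 2 + w) / (1 + w) * x ord0 i ^+ 2); last by field.
by rewrite k1 divff//; ring.
Qed.

Lemma measurable_sqnormD x (k : R) :
  measurable_fun setT (fun t : n.-tuple (measurableTypeR R) =>
    sqnorm (x + k *: vec_of_tuple t)).
Proof.
apply: measurable_sum => i; apply: measurable_funX.
under eq_fun do rewrite !mxE.
apply: measurable_funD => //; apply: measurable_funM => //.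
exact: measurable_tnth.
Qed.

Lemma measurable_sqnorm :
  measurable_fun setT (fun t : n.-tuple (measurableTypeR R) => sqnorm (vec_of_tuple t)).
Proof.
have := measurable_sqnormD 0 1.
by under eq_fun do rewrite add0r scale1r.
Qed.

End sqnorm.

Section gauss_vec.
Context {R : realType} {n : nat}.
Local Notation nu := (lebesgue_tuple R n).
Local Notation m := (n%:R / 2 : R).

Lemma integral_gauss_sqnorm (C c : R) : 0 <= C -> 0 < c ->
  (\int[nu]_t (C * expR (- (c * sqnorm (vec_of_tuple t))))%:E =
   (C * (pi / c) `^ m)%:E)%E.
Proof.
move=> C0 c0; under eq_integral => t _ do rewrite sqnorm_vec EFinM.
by rewrite ge0_integralZl_EFin ?integral_gauss_tuple//; exact: measurable_gauss_tuple.
Qed.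

Lemma integral_gauss_sqnormD (C t w k : R) (x : 'rV[R]_n) :
  0 <= C -> 0 < t -> 0 < w -> k ^+ 2 = 1 ->
  (\int[nu]_z (C * expR (- (t * (sqnorm (x + k *: vec_of_tuple z) +
                        w * sqnorm (vec_of_tuple z)))))%:E =
   (C * expR (- (t * (w / (1 + w) * sqnorm x))) * (pi / (t * (1 + w))) `^ m)%:E)%E.
Proof.
move=> C0 t0 w0 k1.
transitivity (\int[nu]_z ((C * expR (- (t * (w / (1 + w) * sqnorm x))))%:E *
    (expR (- (t * (1 + w) *
      \sum_(i < n) (tnth z i - (- k * x ord0 i / (1 + w))) ^+ 2)))%:E))%E.
  apply: eq_integral => z _; rewrite -EFinM -[C * expR _ * _]mulrA -expRD sqnormD_square//.
  by congr (_ * expR _)%:E; ring.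
rewrite ge0_integralZl_EFin//; last 2 first.
- exact: measurable_gauss_tuple.
- by rewrite mulr_ge0 ?expR_ge0.
by rewrite integral_gauss_tuple// mulr_gt0// addr_gt0.
Qed.

End gauss_vec.

(** * The two signed parts integrated against the kernel *)

Section kernel_integrals.
Context {R : realType} {n : nat} (s : R).
Context (s0 : 0 < s) (s1 : s < 1) (sn : 2 * s < n%:R).
Local Notation mu := (@lebesgue_measure R).
Local Notation pos := (`]0%R, +oo[%classic : set R).
Local Notation nu := (lebesgue_tuple R n).
Local Notation m := (n%:R / 2 : R).
Local Notation a := (m - s).
Local Notation b := (m + s).
Local Notation sqv t := (sqnorm (vec_of_tuple t)).

Let m0 : 0 < m. Proof. by rewrite divr_gt0// (lt_trans _ sn)// mulr_gt0. Qed.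
Let a0 : 0 < a. Proof. by rewrite subr_gt0 ltr_pdivlMr// mulrC. Qed.
Let b0 : 0 < b. Proof. exact: addr_gt0. Qed.

(** The value of the integral in [integral_powR_beta] for m = n/2. *)
Let beta (D h : R) :=
  Gamma b * Gamma (1 - s) / (s * Gamma m) * D `^ (- b) * h `^ s.
(** pi^m comes from the Gaussian integral in z, Gamma(m) from the Gamma integral in t, and the
    denominator from the subordination formula. *)
Let K := pi `^ m * Gamma m / (Gamma a * Gamma b).

(** This is where a + b = n acts: t^(n-1) times the Gaussian factor t^(-n/2) leaves t^(m-1), the
    weight of a Gamma integral of parameter m, independent of s. *)
Let gauss_powE (t w : R) : 0 < t -> 0 < w ->
  t `^ (a + b - 1) * (pi / (t * w)) `^ m = pi `^ m * w `^ (- m) * t `^ (m - 1).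
Proof.
move=> t0 w0; have pi0 := pi_gt0 R.
rewrite (powR_div _ _ _ (ltW pi0)) ?mulr_ge0 ?ltW// (powRM _ (ltW t0) (ltW w0)).
have -> : m - 1 = a + b - 1 + - m by field.
by rewrite (gt0_powRD _ (a + b - 1))//; ring.
Qed.

(** The Gaussians in z have the different rates t w and t (1 + w) but share the factor exp(-D t).
    Integrating in t therefore gives (w D)^(-m) and ((1 + w) D)^(-m), that is, the Beta-type
    integral with h = D. *)
Lemma integral_radial_part (D : R) : 0 < D ->
  (\int[nu]_z ((D `^ (- a) - (D + sqv z) `^ (- a)) / sqv z `^ b)%:E =
   (K * beta D D)%:E)%E.
Proof.
move=> D0.
pose psi (z : n.-tuple (measurableTypeR R)) (t : R) :=
  expR (- (D * t)) - expR (- ((D + sqv z) * t)).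
rewrite (integral_subordination nu (fun z => sqv z) psi
  (fun z => D `^ (- a) - (D + sqv z) `^ (- a)) a b a0 b0); last 6 first.
- exact: measurable_sqnorm.
- by move=> z; exact: sqnorm_ge0.
- apply: measurable_funB; apply: measurable_expRN; apply: measurable_funM => //.
  apply: measurable_funD => //.
  exact: (measurableT_comp measurable_sqnorm measurable_fst).
- move=> z t t0; rewrite subr_ge0 ler_expR lerN2 ler_wpM2r ?(ltW t0)// lerDl.
  exact: sqnorm_ge0.
- by move=> z t qz; rewrite /psi qz addr0 subrr.
- by move=> z; apply: integral_gammaB => //; rewrite lerDl sqnorm_ge0.
transitivity (((Gamma a * Gamma b)^-1)%:E * \int[mu]_(w in pos)
  ((pi `^ m * Gamma m)%:E *
   (w `^ (b - 1) * ((w * D) `^ (- m) - (D + w * D) `^ (- m)))%:E))%E.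
  congr (_ * _)%E; apply: eq_integral => w; rewrite inE/= in_itv/= andbT => w0.
  transitivity (\int[mu]_(t in pos)
      ((w `^ (b - 1) * pi `^ m * (w `^ (- m) - (1 + w) `^ (- m)))%:E *
       (t `^ (m - 1) * expR (- (D * t)))%:E))%E.
    apply: eq_integral => t; rewrite inE/= in_itv/= andbT => t0.
    have tw0 : 0 < t * w by rewrite mulr_gt0.
    have tw1 : 0 < t * (1 + w) by rewrite mulr_gt0// addr_gt0.
    transitivity ((w `^ (b - 1) * t `^ (a + b - 1))%:E *
      (expR (- (D * t)) * (pi / (t * w)) `^ m -
       expR (- (D * t)) * (pi / (t * (1 + w))) `^ m)%:E)%E.
      congr (_ * _)%E.
      rewrite -(ge0_integralB_fin nu setT measurableT
        (fun z => expR (- (D * t)) * expR (- (t * w * sqv z)))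
        (fun z => expR (- (D * t)) * expR (- (t * (1 + w) * sqv z)))).
      + apply: eq_integral => z _; rewrite /psi mulrBl -!expRD.
        by congr (_ - expR _)%:E; ring.
      + apply: measurable_funM => //; apply: measurable_expRN.
        by apply: measurable_funM => //; exact: measurable_sqnorm.
      + by move=> z _; rewrite mulr_ge0 ?expR_ge0.
      + apply: measurable_funM => //; apply: measurable_expRN.
        by apply: measurable_funM => //; exact: measurable_sqnorm.
      + by move=> z _; rewrite mulr_ge0 ?expR_ge0.
      + by rewrite integral_gauss_sqnorm ?expR_ge0.
      + by rewrite integral_gauss_sqnorm ?expR_ge0.
    rewrite -!EFinM; congr EFin; rewrite -mulrBr.
    transitivity (w `^ (b - 1) * expR (- (D * t)) *
      (t `^ (a + b - 1) * (pi / (t * w)) `^ m -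
       t `^ (a + b - 1) * (pi / (t * (1 + w))) `^ m)); first by ring.
    by rewrite !gauss_powE ?addr_gt0//; ring.
  rewrite ge0_integralZl_EFin//; last 3 first.
  - by move=> t _; rewrite lee_fin mulr_ge0 ?powR_ge0 ?expR_ge0.
  - apply: measurable_funTS; apply/measurable_EFinP; apply: measurable_funM.
      exact: measurable_powR.
    by apply: measurable_expRN; exact: measurable_funM.
  - rewrite !mulr_ge0 ?powR_ge0// subr_ge0 !powRN lef_pV2 ?posrE ?powR_gt0 ?addr_gt0//.
    by rewrite ge0_ler_powR ?nnegrE ?ltW// ?addr_gt0// ltrDr.
  rewrite integral_gamma_scale// -!EFinM; congr EFin.
  have -> : D + w * D = (1 + w) * D by ring.
  by rewrite !powRM ?ltW ?addr_gt0//; ring.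
rewrite ge0_integralZl_EFin//; last 3 first.
- move=> w; rewrite /= in_itv/= andbT => w0.
  rewrite lee_fin mulr_ge0 ?powR_ge0// subr_ge0 !powRN.
  have wD0 : 0 < w * D by rewrite mulr_gt0.
  rewrite lef_pV2 ?posrE ?powR_gt0 ?addr_gt0//.
  by rewrite ge0_ler_powR ?nnegrE ?ltW// ?addr_gt0// ltrDr.
- apply: measurable_funTS; apply/measurable_EFinP; apply: measurable_funM.
    exact: measurable_powR.
  apply: measurable_funB; apply: (measurableT_comp (measurable_powR _)).
    exact: measurable_funM.
  by apply: measurable_funD => //; exact: measurable_funM.
- by rewrite mulr_ge0 ?powR_ge0// ltW// Gamma_gt0.
rewrite integral_powR_beta// -!EFinM; congr EFin.
by rewrite mulrA [X in X * _]mulrC.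
Qed.

Let vecB (x : 'rV[R]_n) (z : n.-tuple (measurableTypeR R)) :
  x - vec_of_tuple z = x + (-1) *: vec_of_tuple z.
Proof. by rewrite scaleN1r. Qed.

Let vecD (x : 'rV[R]_n) (z : n.-tuple (measurableTypeR R)) :
  x + vec_of_tuple z = x + 1 *: vec_of_tuple z.
Proof. by rewrite scale1r. Qed.

(** The power (w D)^(-m) is inserted as an intermediary: each of the two remaining differences is
    covered by [integral_powR_beta], and it cancels between them. *)
Lemma integral_powR_betaB (D h : R) : 0 < D -> 0 < h -> h <= D ->
  (\int[mu]_(w in pos) (w `^ (b - 1) * ((h + w * D) `^ (- m) - (D + w * D) `^ (- m)))%:E =
   (beta D D - beta D h)%:E)%E.
Proof.
move=> D0 h0 hD.
have mf c : measurable_fun pos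
    (fun w : R => w `^ (b - 1) * ((w * D) `^ (- m) - (c + w * D) `^ (- m))).
  apply: measurable_funTS; apply: measurable_funM; first exact: measurable_powR.
  apply: measurable_funB; apply: (measurableT_comp (measurable_powR _)).
    exact: measurable_funM.
  by apply: measurable_funD => //; exact: measurable_funM.
have f0 c (w : R) : 0 < c -> pos w ->
    0 <= w `^ (b - 1) * ((w * D) `^ (- m) - (c + w * D) `^ (- m)).
  move=> c0; rewrite /= in_itv/= andbT => w0.
  rewrite mulr_ge0 ?powR_ge0// subr_ge0 !powRN.
  have wD0 : 0 < w * D by rewrite mulr_gt0.
  rewrite lef_pV2 ?posrE ?powR_gt0 ?addr_gt0//.
  by rewrite ge0_ler_powR ?nnegrE ?ltW// ?addr_gt0// ltrDr.
rewrite -(ge0_integralB_fin mu pos _ _ _ _ _ (mf D) (fun w => f0 D w D0)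
  (mf h) (fun w => f0 h w h0)) ?integral_powR_beta//.
by apply: eq_integral => w _; congr EFin; ring.
Qed.

(** In contrast to the radial part, all three Gaussians in z have the rate t (1 + w), so (1 +
    w)^(-m) is a common factor and the difference comes from the exponentials in t that remain. *)
Lemma integral_convex_part (x : 'rV[R]_n) (h : R) : 0 < h ->
  let D := h + sqnorm x in
  (\int[nu]_z (((h + sqnorm (x + vec_of_tuple z)) `^ (- a) +
      (h + sqnorm (x - vec_of_tuple z)) `^ (- a) -
      2 * (D + sqv z) `^ (- a)) / sqv z `^ b)%:E =
   (2 * (K * (beta D D - beta D h)))%:E)%E.
Proof.
move=> h0 D; have D0 : 0 < D by rewrite ltr_wpDr// sqnorm_ge0.
pose g (k : R) (z : n.-tuple (measurableTypeR R)) (t : R) :=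
  expR (- ((h + sqnorm (x + k *: vec_of_tuple z)) * t)).
pose psi (z : n.-tuple (measurableTypeR R)) (t : R) :=
  g 1 z t + g (-1) z t - 2 * expR (- ((D + sqv z) * t)).
have hk0 k z : 0 < h + sqnorm (x + k *: vec_of_tuple z).
  by rewrite ltr_wpDr// sqnorm_ge0.
have Dq0 z : 0 < D + sqv z by rewrite ltr_wpDr// sqnorm_ge0.
have mg k : measurable_fun setT
    (fun zt : n.-tuple (measurableTypeR R) * R => g k zt.1 zt.2).
  apply: measurable_expRN; apply: measurable_funM => //.
  apply: measurable_funD => //.
  exact: (measurableT_comp (measurable_sqnormD x k) measurable_fst).
transitivity (\int[nu]_z (((h + sqnorm (x + 1 *: vec_of_tuple z)) `^ (- a) +
      (h + sqnorm (x + (-1) *: vec_of_tuple z)) `^ (- a) -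
      2 * (D + sqv z) `^ (- a)) / sqv z `^ b)%:E)%E.
  by apply: eq_integral => z _; rewrite vecB vecD.
rewrite (integral_subordination nu (fun z => sqv z) psi
  (fun z => (h + sqnorm (x + 1 *: vec_of_tuple z)) `^ (- a) +
      (h + sqnorm (x + (-1) *: vec_of_tuple z)) `^ (- a) -
      2 * (D + sqv z) `^ (- a)) a b a0 b0); last 6 first.
- exact: measurable_sqnorm.
- by move=> z; exact: sqnorm_ge0.
- apply: measurable_funB; first exact: measurable_funD.
  apply: measurable_funM => //; apply: measurable_expRN; apply: measurable_funM => //.
  apply: measurable_funD => //.
  exact: (measurableT_comp measurable_sqnorm measurable_fst).
- move=> z t t0.
  (* [p] and [r] are the square roots of the two shifted exponentials. By the parallelogram law
     [D + sqv z] is the mean of their rates, so the middle exponential is [p * r] and [psi] is the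
     square of [p - r]. *)
  pose p := expR (- ((h + sqnorm (x + 1 *: vec_of_tuple z)) * t) / 2).
  pose r := expR (- ((h + sqnorm (x + (-1) *: vec_of_tuple z)) * t) / 2).
  rewrite /psi (_ : g 1 z t = p ^+ 2); last first.
    by rewrite /g expr2 -expRD; congr expR; field.
  rewrite (_ : g (-1) z t = r ^+ 2); last first.
    by rewrite /g expr2 -expRD; congr expR; field.
  rewrite (_ : expR _ = p * r); last first.
    rewrite -expRD; congr expR; have := sqnormDB x (vec_of_tuple z).
    rewrite vecB vecD /D => xz.
    transitivity (- (2 * h + 2 * (sqnorm x + sqv z)) * t / 2); first by field.
    by rewrite -xz; field.
  rewrite (_ : _ - _ = (p - r) ^+ 2) ?sqr_ge0//; ring.
- by move=> z t /sqnorm_eq0 z0; rewrite /psi /g z0 !scaler0 /sqnorm addr0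
    [X in D + X]big1 ?addr0 => [|i _]; [rewrite -/(sqnorm x) /D; ring|rewrite mxE expr0n].
- move=> z; pose G c (t : R) := t `^ (a - 1) * expR (- (c * t)).
  have mG c : measurable_fun pos (G c).
    apply: measurable_funTS; apply: measurable_funM; first exact: measurable_powR.
    by apply: measurable_expRN; exact: measurable_funM.
  have G0 c t : pos t -> 0 <= G c t by move=> _; rewrite mulr_ge0 ?powR_ge0 ?expR_ge0.
  have IG c : 0 < c -> (\int[mu]_(t in pos) (G c t)%:E = (Gamma a * c `^ (- a))%:E)%E.
    exact: integral_gamma_scale.
  transitivity (\int[mu]_(t in pos) (G (h + sqnorm (x + 1 *: vec_of_tuple z)) t +
      G (h + sqnorm (x + (-1) *: vec_of_tuple z)) t - 2 * G (D + sqv z) t)%:E)%E.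
    by apply: eq_integral => t _; congr EFin; rewrite /psi /g /G; ring.
  rewrite (ge0_integralDB_fin mu pos _ _ _ _ _ _ _ (mG _) (G0 _) (mG _) (G0 _)
    (mG _) (G0 _) (IG _ (hk0 _ _)) (IG _ (hk0 _ _)) (IG _ (Dq0 _ _)))//.
  by rewrite mulrBr mulrDr [Gamma a * (2 * _)]mulrCA.
transitivity (((Gamma a * Gamma b)^-1)%:E * \int[mu]_(w in pos)
  ((2 * pi `^ m * Gamma m)%:E *
   (w `^ (b - 1) * ((h + w * D) `^ (- m) - (D + w * D) `^ (- m)))%:E))%E.
  congr (_ * _)%E; apply: eq_integral => w; rewrite inE/= in_itv/= andbT => w0.
  have w1 : 0 < 1 + w by rewrite addr_gt0.
  (* The rate in t left after completing the square; (1 + w) [al] equals h + w D. *)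
  pose al := h + w / (1 + w) * sqnorm x.
  have al0 : 0 < al by rewrite ltr_wpDr// mulr_ge0 ?sqnorm_ge0// divr_ge0 ?ltW.
  have alD : al <= D.
    rewrite lerD2l ler_piMl ?sqnorm_ge0// ler_pdivrMr// mul1r lerDr.
    exact: ler01.
  transitivity (\int[mu]_(t in pos)
      ((2 * w `^ (b - 1) * pi `^ m * (1 + w) `^ (- m))%:E *
       (t `^ (m - 1) * (expR (- (al * t)) - expR (- (D * t))))%:E))%E.
    apply: eq_integral => t; rewrite inE/= in_itv/= andbT => t0.
    have tw1 : 0 < t * (1 + w) by rewrite mulr_gt0.
    transitivity ((w `^ (b - 1) * t `^ (a + b - 1))%:E *
      (expR (- (al * t)) * (pi / (t * (1 + w))) `^ m +
       expR (- (al * t)) * (pi / (t * (1 + w))) `^ m -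
       2 * (expR (- (D * t)) * (pi / (t * (1 + w))) `^ m))%:E)%E.
      congr (_ * _)%E.
      pose G (k : R) (z : n.-tuple (measurableTypeR R)) :=
        expR (- (h * t)) * expR (- (t * (sqnorm (x + k *: vec_of_tuple z) + w * sqv z))).
      have mG k : measurable_fun setT (G k).
        apply: measurable_funM => //; apply: measurable_expRN.
        apply: measurable_funM => //; apply: measurable_funD.
          exact: measurable_sqnormD.
        by apply: measurable_funM => //; exact: measurable_sqnorm.
      have IG k : k ^+ 2 = 1 -> (\int[nu]_z (G k z)%:E =
          (expR (- (al * t)) * (pi / (t * (1 + w))) `^ m)%:E)%E.
        move=> k1; rewrite integral_gauss_sqnormD ?expR_ge0//.
        by rewrite -expRD; congr (expR _ * _)%:E; rewrite /al; ring.
      have G0 k z : 0 <= G k z by rewrite mulr_ge0 ?expR_ge0.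
      rewrite -(ge0_integralDB_fin nu setT measurableT (G 1) (G (-1))
        (fun z => expR (- (D * t)) * expR (- (t * (1 + w) * sqv z)))).
      + apply: eq_integral => z _; congr EFin.
        have gG k : g k z t * expR (- (t * w * sqv z)) = G k z.
          by rewrite /g /G -!expRD; congr expR; ring.
        have gD : expR (- ((D + sqv z) * t)) * expR (- (t * w * sqv z)) =
            expR (- (D * t)) * expR (- (t * (1 + w) * sqv z)).
          by rewrite -!expRD; congr expR; ring.
        by rewrite -(gG 1) -(gG (-1)) -gD /psi mulrBl mulrDl -[2 * _ * _]mulrA.
      + exact: mG.
      + by move=> z _; exact: G0.
      + exact: mG.
      + by move=> z _; exact: G0.
      + apply: measurable_funM => //; apply: measurable_expRN.
        by apply: measurable_funM => //; exact: measurable_sqnorm.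
      + by move=> z _; rewrite mulr_ge0 ?expR_ge0.
      + by rewrite IG// expr1n.
      + by rewrite IG// sqrrN expr1n.
      + by rewrite integral_gauss_sqnorm ?expR_ge0.
    rewrite -!EFinM; congr EFin.
    transitivity (2 * w `^ (b - 1) * (expR (- (al * t)) - expR (- (D * t))) *
      (t `^ (a + b - 1) * (pi / (t * (1 + w))) `^ m)); first by ring.
    by rewrite gauss_powE//; ring.
  rewrite ge0_integralZl_EFin//; last 3 first.
  - move=> t; rewrite /= in_itv/= andbT => t0; rewrite lee_fin mulr_ge0 ?powR_ge0//.
    by rewrite subr_ge0 ler_expR lerN2 ler_wpM2r ?(ltW t0).
  - apply: measurable_funTS; apply/measurable_EFinP; apply: measurable_funM.
      exact: measurable_powR.
    by apply: measurable_funB; apply: measurable_expRN; exact: measurable_funM.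
  - by rewrite !mulr_ge0 ?powR_ge0.
  rewrite integral_gammaB// -!EFinM; congr EFin.
  have -> : h + w * D = (1 + w) * al by rewrite /al /D; field; rewrite gt_eqF.
  have -> : D + w * D = (1 + w) * D by ring.
  by rewrite !(powRM _ (ltW w1)) ?(ltW al0) ?(ltW D0)//; ring.
rewrite ge0_integralZl_EFin//; last 3 first.
- move=> w; rewrite /= in_itv/= andbT => w0.
  rewrite lee_fin mulr_ge0 ?powR_ge0// subr_ge0 !powRN.
  have wD0 : 0 < w * D by rewrite mulr_gt0.
  have hw0 := addr_gt0 h0 wD0; have Dw0 := addr_gt0 D0 wD0.
  rewrite lef_pV2 ?posrE ?powR_gt0//.
  rewrite ge0_ler_powR ?(ltW m0) ?nnegrE ?(ltW hw0) ?(ltW Dw0)//.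
  by rewrite lerD2r lerDl sqnorm_ge0.
- apply: measurable_funTS; apply/measurable_EFinP; apply: measurable_funM.
    exact: measurable_powR.
  by apply: measurable_funB; apply: (measurableT_comp (measurable_powR _));
    apply: measurable_funD => //; exact: measurable_funM.
- by rewrite !mulr_ge0 ?powR_ge0// ltW// Gamma_gt0.
rewrite integral_powR_betaB//; last by rewrite lerDl sqnorm_ge0.
have alg (u p c X : R) : u * (2 * p * c * X) = 2 * (p * c * u * X) by ring.
by rewrite -!EFinM alg.
Qed.

End kernel_integrals.

(** * The integral of the second difference *)

Section second_difference.
Context {R : realType} {n : nat} (s : R).
Context (s0 : 0 < s) (s1 : s < 1) (sn : 2 * s < n%:R).
Local Notation nu := (lebesgue_tuple R n).
Local Notation m := (n%:R / 2 : R).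
Local Notation a := (m - s).
Local Notation b := (m + s).
Local Notation sqv t := (sqnorm (vec_of_tuple t)).

(** The terms [beta D D] of the two parts cancel in 2 f - g, leaving 2 K [beta D h]; there the
    factors Gamma(m) and Gamma(b) of [K] and [beta] cancel as well. [C] is to be the amplitude of
    the bubble. *)
Lemma Rintegral_second_difference (x : 'rV[R]_n) (h C : R) : 0 < h ->
  \int[nu]_z (C * (2 * (h + sqnorm x) `^ (- a) - (h + sqnorm (x + vec_of_tuple z)) `^ (- a)
     - (h + sqnorm (x - vec_of_tuple z)) `^ (- a)) / sqv z `^ b) =
  C * (2 * pi `^ m * Gamma (1 - s) / (s * Gamma a) * h `^ s * (h + sqnorm x) `^ (- b)).
Proof.
move=> h0; have : 0 < h + sqnorm x by rewrite ltr_wpDr// sqnorm_ge0.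
set D := h + sqnorm x => D0.
have m0 : 0 < m by rewrite divr_gt0// (lt_trans _ sn)// mulr_gt0.
have a0 : 0 < a by rewrite subr_gt0 ltr_pdivlMr// mulrC.
have b0 : 0 < b by rewrite addr_gt0.
pose r (v : 'rV[R]_n) := (h + sqnorm v) `^ (- a).
have mr k : measurable_fun setT
    (fun z : n.-tuple (measurableTypeR R) => r (x + k *: vec_of_tuple z)).
  apply: (measurableT_comp (measurable_powR _)); apply: measurable_funD => //.
  exact: measurable_sqnormD.
have mD : measurable_fun setT
    (fun z : n.-tuple (measurableTypeR R) => (D + sqv z) `^ (- a)).
  apply: (measurableT_comp (measurable_powR _)); apply: measurable_funD => //.
  exact: measurable_sqnorm.
have mq : measurable_fun setT
    (fun z : n.-tuple (measurableTypeR R) => (sqv z `^ b)^-1).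
  under eq_fun do rewrite -powRN.
  apply: (measurableT_comp (measurable_powR _)); exact: measurable_sqnorm.
pose f (z : n.-tuple (measurableTypeR R)) :=
  (D `^ (- a) - (D + sqv z) `^ (- a)) / sqv z `^ b.
pose g (z : n.-tuple (measurableTypeR R)) :=
  (r (x + vec_of_tuple z) + r (x - vec_of_tuple z) - 2 * (D + sqv z) `^ (- a))
   / sqv z `^ b.
have mf : measurable_fun setT f.
  by apply: measurable_funM => //; exact: measurable_funB.
have mg : measurable_fun setT g.
  apply: measurable_funM => //; apply: measurable_funB; last exact: measurable_funM.
  apply: measurable_funD.
    rewrite (_ : (fun z => _) = fun z => r (x + 1 *: vec_of_tuple z)); first exact: mr.
    by apply/funext => z; rewrite scale1r.
  rewrite (_ : (fun z => _) = fun z => r (x + (-1) *: vec_of_tuple z)); first exact: mr.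
  by apply/funext => z; rewrite scaleN1r.
have f0 z : 0 <= f z.
  rewrite divr_ge0 ?powR_ge0// subr_ge0 !powRN.
  have Dz : D <= D + sqv z by rewrite lerDl sqnorm_ge0.
  have Dz0 := lt_le_trans D0 Dz.
  rewrite lef_pV2 ?posrE ?powR_gt0//.
  by rewrite ge0_ler_powR ?nnegrE ?(ltW a0) ?(ltW D0) ?(ltW Dz0).
have g0 z : 0 <= g z.
  rewrite divr_ge0 ?powR_ge0// subr_ge0.
  rewrite (_ : D + sqv z = (h + sqnorm (x + vec_of_tuple z) +
      (h + sqnorm (x - vec_of_tuple z))) / 2); last first.
    by rewrite addrACA sqnormDB /D; field.
  by rewrite powRN_midpoint// ltr_wpDr// sqnorm_ge0.
have [A fA AE] : {A : R | (\int[nu]_z (f z)%:E = A%:E)%E & A =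
    pi `^ m * Gamma m / (Gamma a * Gamma b) *
    (Gamma b * Gamma (1 - s) / (s * Gamma m) * D `^ (- b) * D `^ s)}.
  by eexists; [exact: integral_radial_part s s0 s1 sn D D0|reflexivity].
have If2 : (\int[nu]_z (2 * f z)%:E = (2 * A)%:E)%E.
  under eq_integral => z _ do rewrite EFinM.
  rewrite ge0_integralZl_EFin//; first by rewrite fA.
    by move=> z _; rewrite lee_fin.
  exact/measurable_EFinP.
have f20 z : setT z -> 0 <= 2 * f z by move=> _; rewrite mulr_ge0.
have mf2 : measurable_fun setT (fun z => 2 * f z) by exact: measurable_funM.
have I2 := ge0_integralB_fin nu setT measurableT (fun z => 2 * f z) g _ _ mf2 f20 mg
  (fun z _ => g0 z) If2 (integral_convex_part s s0 s1 sn x h h0).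
transitivity (\int[nu]_z (C * (2 * f z - g z))).
  apply: eq_Rintegral => z _; rewrite -mulrA; congr (_ * _).
  rewrite /f /g mulrA -mulrBl; congr (_ / _).
  have alg (p u v w : R) : 2 * p - u - v = 2 * (p - w) - (u + v - 2 * w) by ring.
  exact: alg.
rewrite RintegralZl//; last first.
  apply: (integrableB measurableT (f := fun z => (2 * f z)%:E) (g := fun z => (g z)%:E)).
    exact: (ge0_integrable_fin nu setT _ _ mf2 f20 If2).
  exact: (ge0_integrable_fin nu setT _ _ mg (fun z _ => g0 z)
    (integral_convex_part s s0 s1 sn x h h0)).
congr (_ * _); rewrite /Rintegral {}I2 /= -/D AE.
have := Gamma_gt0 _ a0; have := Gamma_gt0 _ b0; have := Gamma_gt0 _ m0.
move: (Gamma a) (Gamma b) (Gamma m) (Gamma (1 - s)) (pi `^ m) (D `^ (- b)) (h `^ s) (D `^ s).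
move=> ga gb gm g1 p Db hs Ds gm0 gb0 ga0.
by field; rewrite !gt_eqF.
Qed.

End second_difference.

(** * Smoothness *)

Section smoothness.
Context {R : realType} {n : nat}.
Implicit Types (f g : 'rV[R]_n -> R) (v x : 'rV[R]_n).

Lemma derive_line f x v : 'D_1 (fun h : R => f (h *: v + x)) 0 = 'D_v f x.
Proof.
rewrite /derive; set g1 := fun h => h^-1 *: _; set g2 := fun h => h^-1 *: _.
suff -> : g1 = g2 by [].
by rewrite funeqE /g1 /g2 => h /=; rewrite addr0 scale0r add0r [_%:A]mulr1.
Qed.

Lemma is_derive_line f x v (l : R) :
  is_derive (0 : R) (1 : R) (fun h : R => f (h *: v + x)) l <-> is_derive x v f l.
Proof.
split=> -[df dl]; split.
- exact: (derivable1P f x v).2 df.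
- by rewrite -derive_line.
- exact: (derivable1P f x v).1 df.
- by rewrite derive_line.
Qed.

(** On the line through [x] in direction [v] this is the one-variable chain rule, so only the
    derivative of [f] along [v] enters. *)
Lemma is_derive_compl (phi : R -> R) f x v (p l : R) :
  is_derive (f x) 1 phi p -> is_derive x v f l ->
  is_derive x v (fun z => phi (f z)) (p * l).
Proof.
move=> dphi /is_derive_line df; apply/is_derive_line.
apply: (@is_derive1_comp R phi (fun h : R => f (h *: v + x))) => //.
by rewrite scale0r add0r.
Qed.

Lemma is_derive_coord (j : 'I_n) x v : is_derive x v (fun z => z ord0 j) (v ord0 j).
Proof.
apply/is_derive_line.
rewrite (_ : (fun h : R => _) = (fun h : R => v ord0 j * h + x ord0 j)); last first.
  by apply/funext => h; rewrite !mxE mulrC.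
apply: is_derive_eq; by rewrite addr0 scaler1.
Qed.

Lemma is_CkW k f : is_Ck k.+1 f -> is_Ck k f.
Proof.
elim: k f => [f []//|k IH f [cf df]]; split => // i.
by have [dfi Cfi] := df i; split => //; exact: IH.
Qed.

Lemma is_Ck_cst k (c : R) : is_Ck k (fun _ : 'rV[R]_n => c).
Proof.
elim: k c => [|k IH] c; first exact: cst_continuous.
split=> [|i]; first exact: cst_continuous.
split=> [x|]; first exact: derivable_cst.
rewrite (_ : 'D_(_) _ = fun _ => 0); first exact: IH.
by apply/funext => x; rewrite derive_cst.
Qed.

Lemma is_CkD k f g : is_Ck k f -> is_Ck k g -> is_Ck k (fun x => f x + g x).
Proof.
elim: k f g => [f g cf cg x|k IH f g [cf df] [cg dg]].
  exact: (cvgD (cf x) (cg x)).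
split=> [x|i]; first exact: (cvgD (cf x) (cg x)).
have [dfi Cfi] := df i; have [dgi Cgi] := dg i.
split=> [x|]; first exact: derivableD.
rewrite (_ : 'D_(_) _ = fun x => 'D_(delta_mx ord0 i) f x + 'D_(delta_mx ord0 i) g x).
  exact: IH.
by apply/funext => x; exact: deriveD.
Qed.

Lemma is_CkM k f g : is_Ck k f -> is_Ck k g -> is_Ck k (fun x => f x * g x).
Proof.
elim: k f g => [f g cf cg x|k IH f g Cf Cg].
  exact: (cvgM (cf x) (cg x)).
have [cf df] := Cf; have [cg dg] := Cg.
split=> [x|i]; first exact: (cvgM (cf x) (cg x)).
have [dfi Cfi] := df i; have [dgi Cgi] := dg i.
split=> [x|]; first exact: derivableM.
rewrite (_ : 'D_(_) _ = fun x => f x * 'D_(delta_mx ord0 i) g x +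
   g x * 'D_(delta_mx ord0 i) f x).
  (* The product rule keeps one factor undifferentiated, and that factor has to be lowered from
     order k + 1 to order k. *)
  by apply: is_CkD; apply: IH => //; exact: is_CkW.
by apply/funext => x; exact: deriveM.
Qed.

Lemma is_Ck_coord k (j : 'I_n) : is_Ck k (fun x : 'rV[R]_n => x ord0 j).
Proof.
case: k => [|k]; first exact: coord_continuous.
split=> [|i]; first exact: coord_continuous.
split=> [x|]; first by have [] := is_derive_coord j x (delta_mx ord0 i).
rewrite (_ : 'D_(_) _ = fun _ => (delta_mx ord0 i : 'rV[R]_n) ord0 j); first exact: is_Ck_cst.
by apply/funext => x; have [_ ->] := is_derive_coord j x (delta_mx ord0 i).
Qed.

Lemma is_Ck_sum k (F : 'I_n -> 'rV[R]_n -> R) : (forall i, is_Ck k (F i)) ->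
  is_Ck k (fun x => \sum_(i < n) F i x).
Proof.
move=> CF; elim: (index_enum _) => [|i r IH].
  by under eq_fun do rewrite big_nil; exact: is_Ck_cst.
by under eq_fun do rewrite big_cons; exact: is_CkD.
Qed.

(** Each derivative replaces the exponent p by p - 1, so the induction on [k] runs over all
    exponents at once; positivity of [f] makes every one of these powers differentiable. *)
Lemma is_Ck_powR k f (p : R) : (forall x, 0 < f x) -> is_Ck k f ->
  is_Ck k (fun x => f x `^ p).
Proof.
move=> f0.
have cpow : continuous f -> forall q, continuous (fun x => f x `^ q).
  move=> cf q x; apply: (@continuous_comp _ _ _ f (fun u => u `^ q)); first exact: cf.
  by apply/differentiable_continuous/derivable1_diffP; apply: derivable_powR;
    rewrite in_itv/= f0.
elim: k p => [p cf|k IH p Cf]; first exact: cpow.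
have [cf df] := Cf; split=> [|i]; first exact: cpow.
have [dfi Cfi] := df i.
have dpow x : is_derive x (delta_mx ord0 i) (fun z => f z `^ p)
    (p * f x `^ (p - 1) * 'D_(delta_mx ord0 i) f x).
  apply: (is_derive_compl (fun u : R => u `^ p)); first exact: is_derive1_powR.
  exact/derivableP.
split=> [x|]; first by have [] := dpow x.
rewrite (_ : 'D_(_) _ = fun x => p * f x `^ (p - 1) * 'D_(delta_mx ord0 i) f x).
  by do 2?apply: is_CkM => //; [exact: is_Ck_cst|apply: IH; exact: is_CkW].
by apply/funext => x; have [_ ->] := dpow x.
Qed.

Lemma is_Ck_sqnormB k (c : 'rV[R]_n) : is_Ck k (fun x => sqnorm (x - c)).
Proof.
apply: is_Ck_sum => i.
rewrite (_ : (fun x => _) = fun x : 'rV[R]_n =>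
  (x ord0 i + - c ord0 i) * (x ord0 i + - c ord0 i)); last first.
  by apply/funext => x; rewrite !mxE expr2.
by apply: is_CkM; apply: is_CkD; (exact: is_Ck_coord || exact: is_Ck_cst).
Qed.

End smoothness.

(** * Bubbles *)

Section bubble.
Context {R : realType} {n : nat} (s : R).
Context (s0 : 0 < s) (s1 : s < 1) (sn : 2 * s < n%:R).
Local Notation m := (n%:R / 2 : R).
Local Notation a := (m - s).
Local Notation b := (m + s).

Let aE : (n%:R - 2 * s) / 2 = a. Proof. by field. Qed.
Let bE : (n%:R + 2 * s) / 2 = b. Proof. by field. Qed.
Let a0 : 0 < a. Proof. by rewrite subr_gt0 ltr_pdivlMr// mulrC. Qed.
Let b0 : 0 < b. Proof. by rewrite addr_gt0// divr_gt0// (lt_trans _ sn)// mulr_gt0. Qed.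

Lemma bubble_const_gt0 : 0 < bubble_const n s.
Proof.
by rewrite /bubble_const aE bE mulr_gt0 ?powR_gt0 ?divr_gt0 ?Gamma_gt0.
Qed.

(** This identity dictates the constant: b/a - 1 = 2s/a, while the exponent (n - 2s)/(4s) is a/(2s).
    Raising to b/a thus multiplies the constant by exactly the factor 2^(2s) Gamma(b)/Gamma(a) that
    the fractional Laplacian produces. *)
Lemma bubble_const_powR :
  bubble_const n s `^ (b / a) =
  bubble_const n s * (2 `^ (2 * s) * (Gamma b / Gamma a)).
Proof.
have Gb := Gamma_gt0 _ b0; have Ga := Gamma_gt0 _ a0.
rewrite /bubble_const aE bE; set G := Gamma b / Gamma a.
have G0 : 0 < G by exact: (divr_gt0 Gb Ga).
rewrite powRM ?powR_ge0// -!powRrM.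
have ba : b = a + 2 * s by ring.
have -> : a * (b / a) = a + 2 * s by rewrite mulrC divfK ?gt_eqF.
have -> : (n%:R - 2 * s) / (4 * s) * (b / a) = (n%:R - 2 * s) / (4 * s) + 1.
  have -> : n%:R - 2 * s = 2 * a by field.
  have alg (u : R) : 0 < u -> 2 * u / (4 * s) * ((u + 2 * s) / u) = 2 * u / (4 * s) + 1.
    by move=> u0; field; rewrite !gt_eqF.
  by rewrite ba alg.
rewrite (gt0_powRD 2)// (gt0_powRD G)// (powRr1 (ltW G0)).
by move: (2 `^ _) (2 `^ _) (G `^ _) => ? ? ?; ring.
Qed.

Lemma bubbleE (y : R) (x : 'rV[R]_n) : 0 < y ->
  bubble s y x = bubble_const n s * y `^ a * (y ^+ 2 + sqnorm x) `^ (- a).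
Proof.
move=> y0; rewrite /bubble aE enorm_sqr powR_div ?(ltW y0)//; first by rewrite mulrA.
by rewrite addr_ge0 ?sqr_ge0 ?sqnorm_ge0.
Qed.

Lemma is_Linfty_bubble (y : R) (c : 'rV[R]_n) : 0 < y ->
  is_Linfty (fun x => bubble s y (x - c)).
Proof.
move=> y0; have C0 : 0 <= bubble_const n s * y `^ a.
  by rewrite mulr_ge0 ?powR_ge0// ltW// bubble_const_gt0.
have h0 : 0 < y ^+ 2 by rewrite exprn_gt0.
rewrite /is_Linfty inE; apply/andP; split; rewrite inE /=.
  rewrite (_ : (fun t => _) = fun t : n.-tuple (measurableTypeR R) =>
      bubble_const n s * y `^ a *
      (y ^+ 2 + sqnorm (- c + 1 *: vec_of_tuple t)) `^ (- a)).
    apply: measurable_funM => //; apply: (measurableT_comp (measurable_powR _)).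
    by apply: measurable_funD => //; exact: measurable_sqnormD.
  by apply/funext => t; rewrite (bubbleE _ _ y0) scale1r [- c + _]addrC.
rewrite /finite_norm unlock /Lnorm; case: ifPn => // _.
(* The bound is the value of the bubble at its centre [c]. *)
apply: (@le_lt_trans _ _ (bubble_const n s * y `^ a * (y ^+ 2) `^ (- a))%:E).
  apply/ess_supP; apply/nearW => t /=.
  rewrite lee_fin bubbleE// ger0_norm ?mulr_ge0 ?powR_ge0 ?(ltW bubble_const_gt0)//.
  rewrite ler_wpM2l// !powRN.
  have hD : y ^+ 2 <= y ^+ 2 + sqnorm (vec_of_tuple t - c) by rewrite lerDl sqnorm_ge0.
  have D0 := lt_le_trans h0 hD.
  rewrite lef_pV2 ?posrE ?powR_gt0//.
  by rewrite ge0_ler_powR ?nnegrE ?(ltW a0) ?(ltW h0) ?(ltW D0).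
exact: ltry.
Qed.

(** The factors s, pi^m and Gamma(1 - s) of [frac_const] cancel those of the integral of the second
    difference, and h = y^2 contributes h^s = y^(2s), which raises y^a to y^b. *)
Lemma frac_laplacian_bubble (y : R) (c x : 'rV[R]_n) : 0 < y ->
  frac_laplacian s (fun x => bubble s y (x - c)) x =
  2 `^ (2 * s) * (Gamma b / Gamma a) * (bubble_const n s * y `^ b *
    (y ^+ 2 + sqnorm (x - c)) `^ (- b)).
Proof.
move=> y0; have h0 : 0 < y ^+ 2 by rewrite exprn_gt0.
have Gb := Gamma_gt0 _ b0; have Ga := Gamma_gt0 _ a0.
have G1 : 0 < Gamma (1 - s) by rewrite Gamma_gt0// subr_gt0.
rewrite /frac_laplacian.
transitivity (frac_const n s / 2 * \int[lebesgue_tuple R n]_z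
    (bubble_const n s * y `^ a *
  (2 * (y ^+ 2 + sqnorm (x - c)) `^ (- a)
   - (y ^+ 2 + sqnorm (x - c + vec_of_tuple z)) `^ (- a)
   - (y ^+ 2 + sqnorm (x - c - vec_of_tuple z)) `^ (- a))
   / sqnorm (vec_of_tuple z) `^ b)).
  apply: (f_equal (fun u => frac_const n s / 2 * u)); apply: eq_Rintegral.
  move=> z _; rewrite /= enorm_powR bE !bubbleE//; congr (_ / _).
  have alg (k p u v : R) : 2 * (k * p) - k * u - k * v = k * (2 * p - u - v) by ring.
  rewrite [x + _ - c]addrAC [x - _ - c]addrAC; exact: alg.
rewrite Rintegral_second_difference// /frac_const bE.
have -> : (y ^+ 2) `^ s = y `^ (2 * s) by rewrite -(powR_mulrn _ (ltW y0)) -powRrM.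
have -> : y `^ b = y `^ a * y `^ (2 * s).
  by rewrite -gt0_powRD//; congr (_ `^ _); ring.
have pi0 : pi `^ m != 0 :> R by rewrite gt_eqF// powR_gt0// pi_gt0.
move: Ga Gb G1 => /lt0r_neq0 Ga /lt0r_neq0 Gb /lt0r_neq0 G1.
have s_neq0 : s != 0 by rewrite gt_eqF.
have alg (g2 gb p g1 k ya ga ys D : R) : p != 0 -> g1 != 0 -> ga != 0 ->
    s * g2 * gb / (p * g1) / 2 * (k * ya * (2 * p * g1 / (s * ga) * ys * D)) =
    g2 * (gb / ga) * (k * (ya * ys) * D).
  by move=> *; field; apply/and4P.
exact: (alg _ (Gamma b) (pi `^ m) (Gamma (1 - s)) _ (y `^ a) (Gamma a) (y `^ (2 * s))).
Qed.

Lemma solves_yamabe_bubble (y : R) (c : 'rV[R]_n) : 0 < y ->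
  solves_yamabe s (fun x => bubble s y (x - c)).
Proof.
move=> y0; have h0 : 0 < y ^+ 2 by rewrite exprn_gt0.
have C0 : 0 < bubble_const n s * y `^ a.
  by rewrite mulr_gt0 ?powR_gt0// bubble_const_gt0.
have D0 x : 0 < y ^+ 2 + sqnorm (x - c) by rewrite ltr_wpDr// sqnorm_ge0.
split.
- rewrite (_ : (fun x => _) = fun x => bubble_const n s * y `^ a *
      (y ^+ 2 + sqnorm (x - c)) `^ (- a)); last first.
    by apply/funext => x; rewrite bubbleE.
  apply: is_CkM; first exact: is_Ck_cst.
  apply: is_Ck_powR => //; apply: is_CkD; first exact: is_Ck_cst.
  exact: is_Ck_sqnormB.
- exact: is_Linfty_bubble.
- by move=> x; rewrite bubbleE// mulr_ge0 ?powR_ge0// ltW.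
- move=> x; rewrite frac_laplacian_bubble// bubbleE//.
  (* The critical exponent b/a takes y^a to y^b and D^(-a) to D^(-b), so only the constants remain
     to be compared. *)
  have -> : (n%:R + 2 * s) / (n%:R - 2 * s) = b / a.
    by rewrite -bE -aE -mulf_div divff// mulr1.
  rewrite powRM ?powR_ge0 ?(ltW C0)// powRM ?powR_ge0 ?(ltW bubble_const_gt0)//.
  rewrite bubble_const_powR -!powRrM mulNr.
  have -> : a * (b / a) = b by rewrite mulrC divfK// gt_eqF.
  by move: (2 `^ _) (Gamma b / _) (y `^ _) (_ `^ (- b)) => ? ? ? ?; ring.
Qed.

End bubble.

Theorem theorem9p1 (R : realType) (n : nat) (s : R)
  (hn : (2 <= n)%N) (hs0 : 0 < s) (hs1 : s < 1) :
  (forall y : R, 0 < y -> solves_yamabe s (@bubble R n s y)) /\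
  (forall (y : R) (a : 'rV[R]_n), 0 < y ->
     solves_yamabe s (fun x : 'rV[R]_n => bubble s y (x - a))).
Proof.
(* Equivalent to a = n/2 - s > 0, the convergence condition for the Gamma integral that represents
   D^(-a). *)
have sn : 2 * s < n%:R.
  by apply: (@lt_le_trans _ _ 2); [rewrite gtr_pMr|rewrite ler_nat].
split=> [y y0|y c y0]; last exact: solves_yamabe_bubble.
have := solves_yamabe_bubble s hs0 hs1 sn y 0 y0.
by under eq_fun do rewrite subr0.
Qed.
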